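(* Let $k$ be a field of characteristic zero, let $d\geq 2$ be an integer, and in the polynomial ring $S=k[x_1,x_2,x_3,x_4,x_5]$ let $$I=(x_1^d,\;x_2^d,\;x_3^d,\;x_1x_2^{d-1},\;x_1x_3^{d-1},\;x_2x_4^{d-1}-x_3x_5^{d-1}).$$ Then $\mathrm{reg}(I)=d^2-1$.
   Context: The ring $S$ carries the standard grading ($\deg x_i=1$). For a finitely generated graded $S$-module $M$ with minimal graded free resolution $\cdots\to F_i\to F_{i-1}\to\cdots\to F_0\to M\to 0$, $F_i=\bigoplus_j S(-a_{ij})$, the Castelnuovo-Mumford regularity is $\mathrm{reg}(M)=\sup_{i,j}\{a_{ij}-i\}$. For a homogeneous ideal $I$, $\mathrm{reg}(I)$ denotes the regularity of $I$ regarded as a graded $S$-module (not of $S/I$). *)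

(* Defs.v *)
From HB Require Import structures.
From mathcomp Require Import all_boot all_order all_algebra.
From mathcomp Require Import mpoly.

Set Implicit Arguments.
Unset Strict Implicit.
Unset Printing Implicit Defensive.

Import Order.TTheory GRing.Theory Num.Theory.
Local Open Scope ring_scope.

Definition ideal_gen (R : comNzRingType) (s : seq R) (f : R) : Prop :=
  exists c : 'I_(size s) -> R, f = \sum_(i < size s) c i * s`_i.

(* Homogeneity of an integer degree; the zero polynomial is homogeneous of
   every degree, and is the only element of negative degree. *)
Definition zhomog (k : fieldType) (n : nat) (e : int) (f : {mpoly k[n]}) : bool :=
  match e with
  | Posz m => f \is m.-homog
  | Negz _ => f == 0
  end.

(* Sequences  ... -> F_1 -> F_0 -> S  of finite free modules
   F_i = \bigoplus_j S(- shift i j). The elements of F_i are row vectors, on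
   which the maps act by right multiplication, so that row j of [diff i]
   (resp. of [aug]) is the image of the j-th basis vector of F_(i+1)
   (resp. of F_0). A finite resolution has [rk i = 0] for large i. *)
Record free_sequence (k : fieldType) (n : nat) := FreeSequence {
  rk : nat -> nat;
  shift : forall i, 'I_(rk i) -> int;
  aug : 'cV[{mpoly k[n]}]_(rk 0);
  diff : forall i, 'M[{mpoly k[n]}]_(rk i.+1, rk i)
}.

(* All maps preserve degrees. *)
Definition graded (k : fieldType) (n : nat) (F : free_sequence k n) : Prop :=
  (forall p, zhomog (shift p) (aug F p 0)) /\
  (forall i p q, zhomog (shift p - shift q) (diff F i p q)).

(* Exactness of  ... -> F_1 -> F_0 -> I -> 0. *)
Definition resolves (k : fieldType) (n : nat) (F : free_sequence k n)
    (I : {mpoly k[n]} -> Prop) : Prop :=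
  [/\ forall f, I f <-> exists v : 'rV_(rk F 0), f = (v *m aug F) 0 0,
      forall v : 'rV_(rk F 0),
        v *m aug F = 0 <-> exists u : 'rV_(rk F 1), v = u *m diff F 0
    & forall i (v : 'rV_(rk F i.+1)),
        v *m diff F i = 0 <-> exists u : 'rV_(rk F i.+2), v = u *m diff F i.+1].

(* The image of F_(i+1) lies in (x_1, ..., x_n) F_i: the entries of the
   matrices have no constant term. *)
Definition minimal (k : fieldType) (n : nat) (F : free_sequence k n) : Prop :=
  forall i p q, (diff F i p q)@_0%MM = 0.

Definition minimal_graded_free_resolution (k : fieldType) (n : nat)
    (I : {mpoly k[n]} -> Prop) (F : free_sequence k n) : Prop :=
  [/\ graded F, resolves F I & minimal F].

Definition is_sup (A : int -> Prop) (r : int) : Prop :=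
  (forall z, A z -> z <= r) /\
  (forall u, (forall z, A z -> z <= u) -> r <= u).

(* [reg_eq I r] says that reg(I) is the integer r, where I is seen as a graded
   module (not S/I). Minimal resolutions are unique up to isomorphism; rather
   than choosing one, we ask that one exists and that all of them give r. *)
Definition reg_eq (k : fieldType) (n : nat) (I : {mpoly k[n]} -> Prop)
    (r : int) : Prop :=
  (exists F, minimal_graded_free_resolution I F) /\
  (forall F, minimal_graded_free_resolution I F ->
     is_sup (fun z => exists i (j : 'I_(rk F i)), z = shift j - i%:Z) r).

(* The variables are numbered from 1: [var k j] is x_j for 1 <= j <= 5. *)
Definition var (k : fieldType) (j : nat) : {mpoly k[5]} := 'X_(inord j.-1).

Definition the_ideal (k : fieldType) (d : nat) : {mpoly k[5]} -> Prop :=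
  let x1 := var k 1%N in let x2 := var k 2%N in let x3 := var k 3%N in
  let x4 := var k 4%N in let x5 := var k 5%N in
  ideal_gen [:: x1 ^+ d; x2 ^+ d; x3 ^+ d;
                x1 * x2 ^+ d.-1; x1 * x3 ^+ d.-1;
                x2 * x4 ^+ d.-1 - x3 * x5 ^+ d.-1].

(* Main.v *)
Require Import Defs.
From HB Require Import structures.
From mathcomp Require Import all_boot all_order all_algebra.
From mathcomp Require Import mpoly ssrcomplements zify.
From Stdlib Require Import Classical ClassicalEpsilon.

Set Implicit Arguments.
Unset Strict Implicit.
Unset Printing Implicit Defensive.

Import Order.TTheory GRing.Theory Num.Theory.
Local Open Scope ring_scope.

(** Put d = e + 1, let S be the polynomial ring and M = S / I. Regularity is read
    off the Koszul homology of M instead of a resolution. In a minimal resolution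
    F of I, the degrees of the basis of F_i are those in which H_(i+1)(x; M) is
    nonzero ([regularity_of_kvanish]): this is dimension shifting along the
    resolution ([kvanish_shift], [kvanish_unshift]), which only uses that Koszul
    homology of free modules vanishes in positive degrees ([free_acyclic]). So
    reg(I) = c + 1 as soon as H_i(x; M) vanishes in degrees above c + i for all i,
    and H_5(x; M), which is the socle of M shifted by 5, is nonzero in degree
    c + 5. Here c = d^2 - 2. The same vanishing bounds the degrees of the generators
    of all syzygy modules. They are then finitely generated, and a minimal
    resolution exists ([exists_minimal_resolution]).

    By the cone construction, a vanishing bound for a subset of the variables is
    inherited by all of them ([kvanish_cons]), so only x_4 and x_5 are left for the
    upper bound; M is finitely generated over k[x_4, x_5].

    The ideal is generated by monomials and by the binomial
    x_2 x_4^e - x_3 x_5^e. Call two monomials equivalent if they are related by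
    exchanging x_2 x_4^e with x_3 x_5^e. Then M has a basis indexed by the classes
    that contain no multiple of a monomial generator, and f lies in I exactly when
    the sum of its coefficients over each of these classes is zero ([mem_idealP]).
    The maps of the Koszul complex of x_4 and x_5 act on classes, and vanishing of
    H_0, H_1 and H_2 in large degrees becomes a statement on exponents
    ([generated_small], [syzygy_small], [socle_small]). The extreme class is that of
    x_2 x_3^e x_4^(e-1) x_5^(e^2-1), of degree d^2 - 2: it survives in M, and each
    variable moves it to the class of a monomial in I ([socle_mon_mul]). *)

(** * Koszul complexes *)

(** A pair (u, v) stands for u + e_x v, so [koszul V l] is the tensor product of
    V with the exterior algebra on the elements of l, built as an iterated cone. *)
Fixpoint koszul (R : comNzRingType) (V : lmodType R) (l : seq R) : lmodType R :=
  if l is _ :: l' then (koszul V l' * koszul V l')%type : lmodType R else V.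

Fixpoint kd (R : comNzRingType) (V : lmodType R) (l : seq R) :
    koszul V l -> koszul V l :=
  match l with
  | [::] => fun _ => 0
  | x :: l' => fun w => (kd w.1 + x *: w.2, - kd w.2)
  end.

(** Homological degree i and internal degree a, the generators e_x having
    degree 1; A is the family of graded pieces of V. *)
Fixpoint kgr (R : comNzRingType) (V : lmodType R) (A : int -> V -> Prop)
    (l : seq R) (i : nat) (a : int) : koszul V l -> Prop :=
  match l with
  | [::] => fun w => if i is 0%N then A a w else w = 0
  | x :: l' => fun w => kgr A i a w.1 /\
      (if i is i'.+1 then kgr A i' (a - 1) w.2 else w.2 = 0)
  end.

Fixpoint kmap (R : comNzRingType) (V W : lmodType R) (f : V -> W) (l : seq R) :
    koszul V l -> koszul W l :=
  match l with
  | [::] => f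
  | x :: l' => fun w => (kmap f w.1, kmap f w.2)
  end.

(** Inclusion of homological degree 0. *)
Fixpoint kbot (R : comNzRingType) (V : lmodType R) (l : seq R) (v : V) :
    koszul V l :=
  match l with
  | [::] => v
  | x :: l' => (kbot l' v, 0)
  end.

(** Multiples of the product of all the e_x. *)
Fixpoint ktop (R : comNzRingType) (V : lmodType R) (l : seq R) (v : V) :
    koszul V l :=
  match l with
  | [::] => v
  | x :: l' => (0, ktop l' v)
  end.

(** Graded submodules are only given through their homogeneous pieces. *)
Definition graded_sub (R : comNzRingType) (V : lmodType R) (l : seq R)
    (A : int -> V -> Prop) : Prop :=
  [/\ forall a, A a 0, forall a u v, A a u -> A a v -> A a (u - v)
    & forall a x v, x \in l -> A a v -> A (a + 1) (x *: v)].

(** Vanishing of the Koszul homology H_i(l; A / N) in degree a, phrased with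
    chains of A that are cycles modulo N, so that no quotient is formed. *)
Definition kvanish (R : comNzRingType) (V : lmodType R)
    (A N : int -> V -> Prop) (l : seq R) (i : nat) (a : int) : Prop :=
  forall w : koszul V l, kgr A i a w -> kgr N i.-1 a (kd w) ->
    exists2 v : koszul V l, kgr A i.+1 a v & kgr N i a (w - kd v).

(** The degree a piece of (l) A. *)
Fixpoint ideal_part (R : comNzRingType) (V : lmodType R)
    (A : int -> V -> Prop) (l : seq R) (a : int) (y : V) : Prop :=
  match l with
  | [::] => y = 0
  | x :: l' => exists2 v, A (a - 1) v & ideal_part A l' a (y - x *: v)
  end.

Section Basic.
Variables (R : comNzRingType) (V : lmodType R).
Implicit Types (l : seq R) (A N : int -> V -> Prop).

Lemma kd_linear l : linear (@kd R V l).
Proof.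
elim: l => [|x l IH] c u v /=; first by rewrite scaler0 addr0.
rewrite !IH; congr pair => /=.
  by rewrite !scalerDr !scalerA [x * c]mulrC addrACA.
by rewrite opprD -scalerN.
Qed.

HB.instance Definition _ l :=
  GRing.isLinear.Build R (koszul V l) (koszul V l) _ (@kd R V l) (kd_linear (l := l)).

Lemma kd0 l : kd (0 : koszul V l) = 0. Proof. by rewrite linear0. Qed.
Lemma kdD l (u v : koszul V l) : kd (u + v) = kd u + kd v. Proof. by rewrite linearD. Qed.
Lemma kdB l (u v : koszul V l) : kd (u - v) = kd u - kd v. Proof. by rewrite linearB. Qed.
Lemma kdN l (u : koszul V l) : kd (- u) = - kd u. Proof. by rewrite linearN. Qed.
Lemma kdZ l x (u : koszul V l) : kd (x *: u) = x *: kd u. Proof. by rewrite linearZ. Qed.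

Lemma kd_kd l (w : koszul V l) : kd (kd w) = 0.
Proof.
elim: l w => [|x l IH] w //=.
by rewrite kdD kdN !IH kdZ scalerN add0r subrr !oppr0.
Qed.

Lemma graded_sub_cons x l A : graded_sub (x :: l) A -> graded_sub l A.
Proof. by case=> h0 hB hZ; split=> // a y v yl; apply: hZ; rewrite inE yl orbT. Qed.

Lemma kgr0 l A i a : graded_sub l A -> kgr A i a (0 : koszul V l).
Proof.
elim: l i a => [|x l IH] i a hA /=; first by case: i => //; case: hA.
have hA' := graded_sub_cons hA.
by split; [exact: IH | case: i => // i; exact: IH].
Qed.

Lemma kgrB l A i a (u v : koszul V l) : graded_sub l A ->
  kgr A i a u -> kgr A i a v -> kgr A i a (u - v).
Proof.
elim: l i a u v => [|x l IH] i a u v hA /=.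
  by case: i => [|i]; [case: hA => _ + _; apply | move=> -> ->; rewrite subrr].
have hA' := graded_sub_cons hA.
move=> [hu1 hu2] [hv1 hv2]; split; first exact: IH.
by case: i hu1 hu2 hv1 hv2 => [|i] _ + _; [move=> -> ->; rewrite subrr | exact: IH].
Qed.

Lemma kgrN l A i a (v : koszul V l) : graded_sub l A ->
  kgr A i a v -> kgr A i a (- v).
Proof. by move=> hA hv; rewrite -sub0r; apply: kgrB => //; exact: kgr0. Qed.

Lemma kgrD l A i a (u v : koszul V l) : graded_sub l A ->
  kgr A i a u -> kgr A i a v -> kgr A i a (u + v).
Proof.
by move=> hA hu hv; rewrite -[v]opprK; apply: kgrB => //; exact: kgrN.
Qed.

Lemma kgrZ l A i a x (v : koszul V l) :
  (forall a v, A a v -> A (a + 1) (x *: v)) ->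
  kgr A i (a - 1) v -> kgr A i a (x *: v).
Proof.
move=> hx; elim: l i a v => [|y l IH] i a v /=.
  case: i => [|i]; last by move=> /= ->; rewrite /= scaler0.
  by move=> /hx; rewrite subrK.
move=> [h1 h2]; split; first exact: IH.
by case: i h1 h2 => [|i] h1 h2; [rewrite h2 scaler0 | exact: IH].
Qed.

Lemma kd_bot0 l A a (w : koszul V l) : kgr A 0 a w -> kd w = 0.
Proof.
elim: l w => [|x l IH] w //= [h1 h2].
by rewrite h2 kd0 scaler0 addr0 oppr0 IH.
Qed.

Lemma kgr_kd l A i a (w : koszul V l) : graded_sub l A ->
  kgr A i.+1 a w -> kgr A i a (kd w).
Proof.
elim: l i a w => [|x l IH] i a w hA.
  by move=> _; exact: (kgr0 (l := [::])).
have hA' := graded_sub_cons hA; move=> [h1 h2] /=; split.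
  apply: kgrD => //; first exact: IH.
  by apply: kgrZ => // b v hv; case: hA => _ _; apply; rewrite ?mem_head.
case: i h1 h2 => [|i] h1 h2; first by rewrite (kd_bot0 h2) oppr0.
by apply: kgrN => //; apply: IH.
Qed.

Lemma kgr_sub l A N i a (w : koszul V l) :
  (forall a v, A a v -> N a v) -> kgr A i a w -> kgr N i a w.
Proof.
move=> hAN; elim: l i a w => [|x l IH] i a w /=; first by case: i => //; apply: hAN.
by case=> h1 h2; split; [exact: IH | case: i h1 h2 => // i _; exact: IH].
Qed.

Lemma kgr_big l A i a (w : koszul V l) : (size l < i)%N -> kgr A i a w -> w = 0.
Proof.
elim: l i a w => [|x l IH] [|i] a w //= hi [h1 h2].
rewrite [w]surjective_pairing (IH _ _ _ _ h1) 1?ltnW //.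
by rewrite (IH _ _ _ _ h2).
Qed.

Lemma kvanish_big l A N i a : graded_sub l A -> graded_sub l N ->
  (size l < i)%N -> kvanish A N l i a.
Proof.
move=> hA hN hi w /(kgr_big hi) -> _; exists 0; first exact: kgr0.
by rewrite kd0 subr0; exact: kgr0.
Qed.

(** The long exact sequence of the cone of x: H_i(x :: l) lies between H_i(l) and
    H_(i-1)(l) shifted by one. A bound of the form [c + i < a] is therefore
    inherited when variables are added. *)
Lemma kvanish_cons x l A N i a : graded_sub (x :: l) A -> graded_sub (x :: l) N ->
  kvanish A N l i a -> (i != 0%N -> kvanish A N l i.-1 (a - 1)) ->
  kvanish A N (x :: l) i a.
Proof.
move=> hA hN Hi Hi1 [u v] [/= hu hv].
have hA' := graded_sub_cons hA; have hN' := graded_sub_cons hN.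
have xA b z : A b z -> A (b + 1) (x *: z).
  by case: hA => _ _ + hz; apply=> //; rewrite mem_head.
have xN b z : N b z -> N (b + 1) (x *: z).
  by case: hN => _ _ + hz; apply=> //; rewrite mem_head.
case: i Hi Hi1 hu hv => [|i] Hi Hi1 /= hu hv.
  subst v; move=> [hd _].
  have [|u' hu' hn] := Hi _ hu; first by rewrite (kd_bot0 hu); exact: kgr0.
  exists (u', 0) => /=; first by split=> //; exact: kgr0.
  by rewrite scaler0 addr0 kd0 oppr0 subr0; split.
move=> [hd1 hd2].
have {}hd2 : kgr N i.-1 (a - 1) (kd v).
  case: i Hi Hi1 hu hv hd1 hd2 => [|i] _ _ _ hv _ hd2.
    by rewrite (kd_bot0 hv); exact: kgr0.
  by rewrite -[kd v]opprK; exact: kgrN.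
have [v' hv' hn] := Hi1 isT _ hv hd2.
have [||u' hu' hn'] := Hi (u + x *: v').
- by apply: kgrD => //; exact: kgrZ.
- have -> : kd (u + x *: v') = (kd u + x *: v) - x *: (v - kd v').
    by rewrite kdD kdZ /= scalerBr opprB addrA addrAC addrK.
  by apply: kgrB => //; apply: kgrZ.
exists (u', - v') => /=.
  by split=> //; exact: kgrN.
split; last by rewrite !kdN /= opprK.
by rewrite scalerN opprB addrA.
Qed.

Lemma kgr_bot l A a v : graded_sub l A -> A a v -> kgr A 0 a (kbot l v).
Proof.
elim: l => [|x l IH] //= hA hv; split=> //.
by apply: IH => //; exact: graded_sub_cons hA.
Qed.

Lemma kgr0P l A a (w : koszul V l) : kgr A 0 a w -> exists2 v, A a v & w = kbot l v.
Proof.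
elim: l w => [|x l IH] w /=; first by exists w.
move=> [/IH [v hv e1] e2]; exists v => //.
by rewrite -e1 -e2 -surjective_pairing.
Qed.

Lemma kgr_botE l A a v : kgr A 0 a (kbot l v) -> A a v.
Proof. by elim: l => [|x l IH] //= [/IH]. Qed.

Lemma kbot_linear l : linear (@kbot R V l).
Proof.
elim: l => [|x l IH] c u v //=.
by rewrite IH; congr pair => /=; rewrite scaler0 addr0.
Qed.

HB.instance Definition _ l :=
  GRing.isLinear.Build R V (koszul V l) _ (@kbot R V l) (kbot_linear l).

Lemma kbotD l (u v : V) : kbot l (u + v) = kbot l u + kbot l v.
Proof. by rewrite linearD. Qed.
Lemma kbotB l (u v : V) : kbot l (u - v) = kbot l u - kbot l v.
Proof. by rewrite linearB. Qed.
Lemma kbotZ l x (u : V) : kbot l (x *: u) = x *: kbot l u.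
Proof. by rewrite linearZ. Qed.

Lemma kbot_inj l : injective (@kbot R V l).
Proof. by elim: l => [|x l IH] u v //= [/IH]. Qed.

Lemma kd_kgr1 l A a (w : koszul V l) : kgr A 1 a w ->
  exists2 y, ideal_part A l a y & kd w = kbot l y.
Proof.
elim: l w => [|x l IH] w /=; first by exists 0.
move=> [/IH [y hy e1] /kgr0P [v hv e2]].
exists (y + x *: v); first by exists v => //; rewrite addrK.
rewrite kbotD kbotZ /= e1 e2; congr pair.
suff -> : kd (kbot l v) = 0 by rewrite oppr0.
by elim: (l) => [|z l' /= ->] //=; rewrite scaler0 addr0 kd0 oppr0.
Qed.

Lemma ideal_part_kd l A a y : graded_sub l A -> ideal_part A l a y ->
  exists2 w : koszul V l, kgr A 1 a w & kd w = kbot l y.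
Proof.
elim: l y => [|x l IH] y hA /=; first by move=> ->; exists 0.
have hA' := graded_sub_cons hA.
case=> v hv /IH [] // w hw e.
exists (w, kbot l v) => /=; first by split=> //; exact: kgr_bot.
congr pair; first by rewrite e kbotB kbotZ subrK.
by rewrite (kd_bot0 (kgr_bot hA' hv)) oppr0.
Qed.

Definition zero_gr (a : int) (v : V) : Prop := v = 0.

Lemma zero_gr_sub l : graded_sub l zero_gr.
Proof.
split=> // [a u v -> ->|a x v _ ->]; first exact: subrr.
exact: scaler0.
Qed.

Lemma kgr_zero l i a (w : koszul V l) : kgr zero_gr i a w <-> w = 0.
Proof.
split; last by move=> ->; exact/kgr0/zero_gr_sub.
elim: l i a w => [|x l IH] i a w /=; first by case: i.
move=> [/IH h1]; case: i => [|i]; first by rewrite {2}[w]surjective_pairing h1 => ->.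
by move/IH=> h2; rewrite [w]surjective_pairing h1 h2.
Qed.

(** The regular sequence argument: x is injective on A / (l) A. *)
Lemma acyclic_cons x l A : graded_sub (x :: l) A ->
  (forall i a, (0 < i)%N -> kvanish A zero_gr l i a) ->
  (forall a v, A (a - 1) v -> ideal_part A l a (x *: v) -> ideal_part A l (a - 1) v) ->
  forall i a, (0 < i)%N -> kvanish A zero_gr (x :: l) i a.
Proof.
move=> hA ac reg i a; case: i => [//|[|i]] _; last first.
  apply: kvanish_cons => //; first exact: zero_gr_sub.
    exact: ac.
  by move=> _; exact: ac.
have hA' := graded_sub_cons hA.
move=> [u v] [/= hu hv] [/kgr_zero e _].
have [v0 hv0 ev] := kgr0P hv.
have hxv : ideal_part A l a (x *: v0).
  have [y hy] := kd_kgr1 (kgrN hA' hu).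
  have -> : kd (- u) = kbot l (x *: v0).
    by rewrite kdN kbotZ /= -ev; apply/eqP; rewrite eq_sym -addr_eq0 addrC e.
  by move/kbot_inj=> ->.
have [v' hv' ev'] := ideal_part_kd hA' (reg _ _ hv0 hxv).
have [||u' hu' hn] := ac 1%N a isT (u + x *: v').
- by apply: kgrD => //; apply: kgrZ => // b z hz; case: hA => _ _; apply; rewrite ?mem_head.
- by apply/kgr_zero; rewrite kdD kdZ /= ev' -ev.
exists (u', - v') => /=.
  by split=> //; exact: kgrN.
split; last by rewrite !kdN /= opprK ev' -ev; apply/kgr_zero; rewrite subrr.
by rewrite scalerN opprB addrA.
Qed.

Lemma ktop_gr l A a v : graded_sub l A -> A a v ->
  kgr A (size l) (a + (size l)%:Z) (ktop l v).
Proof.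
elim: l => [|x l IH] hA hv /=; first by rewrite addr0.
have hA' := graded_sub_cons hA; split; first exact: kgr0.
by rewrite intS [1 + _]addrC addrA addrK; exact: IH.
Qed.

Lemma ktop_grE l A a v : kgr A (size l) a (ktop l v) -> A (a - (size l)%:Z) v.
Proof.
elim: l a => [|x l IH] a /=; first by rewrite subr0.
by move=> [_ /IH]; rewrite intS opprD addrA.
Qed.

Lemma ktopZ l x (v : V) : ktop l (x *: v) = x *: ktop l v.
Proof. by elim: l => [|y l IH] //=; rewrite IH; congr pair; rewrite scaler0. Qed.

(** Up to sign, the components of this differential are the products x v. *)
Lemma kd_top l N a v : graded_sub l N ->
  (forall x, x \in l -> N (a + 1) (x *: v)) ->
  kgr N (size l).-1 (a + (size l)%:Z) (kd (ktop l v)).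
Proof.
elim: l => [|x l IH] hN hv; first exact: (kgr0 (l := [::])).
have hN' := graded_sub_cons hN; rewrite /= kd0 add0r; split.
  rewrite intS addrA -ktopZ; apply: ktop_gr => //.
  by apply: hv; rewrite mem_head.
have {IH}hd : kgr N (size l).-1 (a + (size l)%:Z) (kd (ktop l v)).
  by apply: IH => // y yl; apply: hv; rewrite inE yl orbT.
case: (l) hd hN' => [|y l'] hd hN'; first by rewrite /= oppr0.
by apply: kgrN => //; rewrite intS [1 + _]addrC addrA addrK.
Qed.

(** There are no chains beyond the top, so a socle element outside of N is never a
    boundary. *)
Lemma socle_kvanish l A N a v : graded_sub l A -> graded_sub l N -> A a v ->
  (forall x, x \in l -> N (a + 1) (x *: v)) ->
  kvanish A N l (size l) (a + (size l)%:Z) -> N a v.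
Proof.
move=> hA hN hv hxv /(_ (ktop l v)) [||y hy].
- exact: ktop_gr.
- exact: kd_top.
rewrite (kgr_big _ hy) // kd0 subr0 => /ktop_grE.
by rewrite addrK.
Qed.

End Basic.

Section Map.
Variables (R : comNzRingType) (V W : lmodType R) (f : {linear W -> V}).
Implicit Types (l : seq R).

Lemma kmapB l (u v : koszul W l) : kmap f (u - v) = kmap f u - kmap f v.
Proof.
elim: l u v => [|x l IH] u v /=; first by rewrite linearB.
by rewrite !IH.
Qed.

Lemma kmapZ l x (u : koszul W l) : kmap f (x *: u) = x *: kmap f u.
Proof.
elim: l u => [|y l IH] u /=; first by rewrite linearZ.
by rewrite !IH.
Qed.

Lemma kmap0 l : kmap f (0 : koszul W l) = 0.
Proof. by rewrite -[0](subrr 0) kmapB subrr. Qed.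

Lemma kmapN l (u : koszul W l) : kmap f (- u) = - kmap f u.
Proof. by rewrite -[- u]sub0r kmapB kmap0 sub0r. Qed.

Lemma kmapD l (u v : koszul W l) : kmap f (u + v) = kmap f u + kmap f v.
Proof. by rewrite -{1}[v]opprK kmapB kmapN opprK. Qed.

Lemma kmap_kd l (u : koszul W l) : kmap f (kd u) = kd (kmap f u).
Proof.
elim: l u => [|x l IH] u /=; first by rewrite linear0.
by rewrite kmapD kmapZ kmapN !IH.
Qed.

Lemma kgr_map l (B : int -> W -> Prop) (A : int -> V -> Prop) i a (w : koszul W l) :
  (forall b z, B b z -> A b (f z)) -> kgr B i a w -> kgr A i a (kmap f w).
Proof.
move=> h; elim: l i a w => [|x l IH] i a w /=.
  by case: i => [|i]; [exact: h | move=> ->; rewrite linear0].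
move=> [/IH h1 h2]; split=> //.
by case: i h1 h2 => [|i] _; [move=> ->; rewrite kmap0 | move/IH].
Qed.

Lemma kgr_lift l (B : int -> W -> Prop) (A : int -> V -> Prop) i a (v : koszul V l) :
  (forall b y, A b y -> exists2 z, B b z & f z = y) -> kgr A i a v ->
  exists2 w, kgr B i a w & kmap f w = v.
Proof.
move=> h; elim: l i a v => [|x l IH] i a v /=.
  case: i => [|i]; first exact: h.
  by move=> ->; exists 0 => //; rewrite linear0.
move=> [/IH [w1 h1 e1]]; case: i h1 => [|i] h1.
  move=> e2; exists (w1, 0) => //=; rewrite kmap0 e1.
  by rewrite -e2 -surjective_pairing.
move=> /IH [w2 h2 e2]; exists (w1, w2) => //=.
by rewrite e1 e2 -surjective_pairing.
Qed.

Lemma kgr_ker l (B : int -> W -> Prop) i a (w : koszul W l) :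
  kgr B i a w -> kmap f w = 0 -> kgr (fun b z => B b z /\ f z = 0) i a w.
Proof.
elim: l i a w => [|x l IH] i a w /=; first by case: i.
move=> [h1 h2] [e1 e2]; split; first exact: IH.
by case: i h1 h2 => [|i] _ h2 //; exact: IH.
Qed.

Lemma kgr_kerE l (B : int -> W -> Prop) i a (w : koszul W l) :
  kgr (fun b z => B b z /\ f z = 0) i a w -> kmap f w = 0.
Proof.
elim: l i a w => [|x l IH] i a w /=.
  by case: i => [|i]; [case | move=> ->; rewrite linear0].
move=> [/IH -> h2]; case: i h2 => [->|i /IH ->] //.
by rewrite kmap0.
Qed.

Variables (l : seq R) (A N : int -> V -> Prop) (B : int -> W -> Prop).
Hypotheses (hA : graded_sub l A) (hN : graded_sub l N) (hB : graded_sub l B).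
Hypothesis NA : forall a v, N a v -> A a v.
Hypothesis fN : forall a w, B a w -> N a (f w).
Hypothesis Nf : forall a v, N a v -> exists2 w, B a w & f w = v.
Let C a w := B a w /\ f w = 0.

Lemma ker_graded_sub : graded_sub l C.
Proof.
case: hB => h0 hb hZ; split.
- by move=> a; split=> //; rewrite linear0.
- by move=> a u v [? e1] [? e2]; split; [exact: hb | rewrite linearB e1 e2 subrr].
- by move=> a x v xl [? e]; split; [exact: hZ | rewrite linearZ e /= scaler0].
Qed.

Hypothesis acA : forall i a, (0 < i)%N -> kvanish A (@zero_gr R V) l i a.

(** Dimension shifting. As A is acyclic, the connecting map from H_(i+1)(A / N)
    to H_i(N) is injective, and it is onto for positive i; for i = 0 this also
    holds when N lies in (l) A. Moreover N = B / C. The proof is the diagram chase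
    with representatives. *)
Lemma kvanish_shift i a :
  (i = 0%N -> forall v, N a v -> ideal_part A l a v) ->
  kvanish A N l i.+1 a -> kvanish B C l i a.
Proof.
move=> min van w hw hdw.
have hz : kgr N i a (kmap f w) by exact: kgr_map hw.
have [y hy ey] : exists2 y : koszul V l, kgr A i.+1 a y & kd y = kmap f w.
  case: i min van hw hdw hz => [|i] min van hw hdw hz.
    have [v hv ev] := kgr0P hz.
    have [y hy ey] := ideal_part_kd hA (min erefl _ hv).
    by exists y => //; rewrite ey ev.
  have [||y hy /kgr_zero ey] := acA (ltn0Sn i) (w := kmap f w) (a := a).
  - exact: kgr_sub hz.
  - by apply/kgr_zero; rewrite -kmap_kd; exact: kgr_kerE hdw.
  - by exists y => //; apply/esym/eqP; rewrite -subr_eq0 ey.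
have [|v hv hn] := van y hy; first by rewrite ey.
(* n is a chain of N that bounds the image of w; its lift corrects w. *)
have [w' hw' ew'] := kgr_lift Nf hn.
exists w' => //; apply: kgr_ker; first by apply: kgrB => //; exact: kgr_kd.
by rewrite kmapB kmap_kd ew' kdB kd_kd subr0 ey subrr.
Qed.

Lemma kvanish_unshift i a : kvanish B C l i a -> kvanish A N l i.+1 a.
Proof.
move=> van y hy hdy.
have [w hw ew] := kgr_lift Nf hdy.
have [|w' hw' hc] := van w hw.
  case: i van hy hdy hw => [|i] van hy hdy hw.
    by rewrite (kd_bot0 hw); apply: kgr0; exact: ker_graded_sub.
  apply: kgr_ker; first exact: kgr_kd.
  by rewrite kmap_kd ew kd_kd.
have e : kd y = kd (kmap f w').
  by apply/eqP; rewrite -subr_eq0 -ew -kmap_kd -kmapB (kgr_kerE hc).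
have hw'N : kgr N i.+1 a (kmap f w') by exact: kgr_map hw'.
have [||v hv /kgr_zero ev] := acA (ltn0Sn i) (w := y - kmap f w') (a := a).
- by apply: kgrB => //; exact: kgr_sub hw'N.
- by apply/kgr_zero; rewrite kdB e subrr.
exists v => //; suff -> : y - kd v = kmap f w' by [].
by apply/eqP; rewrite subr_eq addrC -subr_eq; apply/eqP/(subr0_eq ev).
Qed.

(** Where H_1(A / N) vanishes, N has no minimal generators. *)
Lemma ideal_part_gen a :
  (forall v, N a v -> ideal_part A l a v) -> kvanish A N l 1 a ->
  forall v, N a v -> ideal_part N l a v.
Proof.
move=> min van v hv.
have [y hy ey] := ideal_part_kd hA (min _ hv).
have [|z hz hn] := van y hy; first by rewrite ey; exact: kgr_bot.
have [u hu eu] := kd_kgr1 hn.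
move: eu; rewrite kdB kd_kd subr0 ey => /kbot_inj -> //.
Qed.

End Map.

(** * Polynomials and vectors of polynomials, degree by degree *)

Section Poly.
Variables (k : fieldType) (n : nat).
Local Notation S := {mpoly k[n]}.
Implicit Types (f g : S) (m : 'X_{1..n}).

(** A polynomial with prescribed coefficients, supported in degrees below b. *)
Definition mpoly_of (E : 'X_{1..n} -> k) (b : nat) : S :=
  \sum_(m : 'X_{1..n < b}) E m *: 'X_[m].

Lemma mcoeff_mpoly_of E b m :
  (forall m', (b <= mdeg m')%N -> E m' = 0) -> (mpoly_of E b)@_m = E m.
Proof.
move=> hE; case: (ltnP (mdeg m) b) => hm; first exact: mcoeff_mpoly.
rewrite hE // /mpoly_of raddf_sum big1 //= => m' _.
rewrite mcoeffZ mcoeffX; case: eqP => [e|]; last by rewrite mulr0.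
by move: (bmdeg m') hm; rewrite e ltnNge => /negbTE ->.
Qed.

Lemma mcoeff_ge f m : (msize f <= mdeg m)%N -> f@_m = 0.
Proof. by move=> h; apply: memN_msupp_eq0; exact: msize_mdeg_ge. Qed.

Lemma zhomogP e f : zhomog e f <-> (forall m, f@_m != 0 -> (mdeg m)%:Z = e).
Proof.
case: e => e /=; split.
- by move=> /dhomogP h m; rewrite -mcoeff_msupp => /h ->.
- move=> h; apply/dhomogP => m; rewrite mcoeff_msupp => /h.
  by case.
- by move=> /eqP -> m; rewrite mcoeff0 eqxx.
- move=> h; apply/eqP/mpolyP => m; rewrite mcoeff0; apply/eqP.
  by apply: contraT => /h.
Qed.

Lemma zhomog_nz e f m : zhomog e f -> (mdeg m)%:Z != e -> f@_m = 0.
Proof.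
move=> /zhomogP h ne; apply/eqP; apply: contraNT ne => /h ->; exact: eqxx.
Qed.

Lemma zhomog0 e : zhomog e (0 : S).
Proof. by apply/zhomogP => m; rewrite mcoeff0 eqxx. Qed.

Lemma zhomogB e f g : zhomog e f -> zhomog e g -> zhomog e (f - g).
Proof.
move=> /zhomogP hf /zhomogP hg; apply/zhomogP => m; rewrite mcoeffB.
by case: (eqVneq f@_m 0) => [->|/hf //]; rewrite sub0r oppr_eq0 => /hg.
Qed.

Lemma zhomogN e f : zhomog e f -> zhomog e (- f).
Proof. by rewrite -[- f]sub0r; apply: zhomogB; exact: zhomog0. Qed.

Lemma zhomogD e f g : zhomog e f -> zhomog e g -> zhomog e (f + g).
Proof. by move=> hf hg; rewrite -[g]opprK; apply: zhomogB => //; exact: zhomogN. Qed.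

Lemma zhomog_sum e (I : Type) (r : seq I) (P : pred I) (F : I -> S) :
  (forall i, P i -> zhomog e (F i)) -> zhomog e (\sum_(i <- r | P i) F i).
Proof.
move=> h; elim/big_rec: _ => [|i x Pi]; first exact: zhomog0.
exact/zhomogD/h.
Qed.

Lemma zhomogM e1 e2 f g : zhomog e1 f -> zhomog e2 g -> zhomog (e1 + e2) (f * g).
Proof.
move=> /zhomogP hf /zhomogP hg; apply/zhomogP => m; rewrite -mcoeff_msupp => /msuppM_le.
case/allpairsP => -[m1 m2] /= [h1 h2 ->].
by rewrite mdegD PoszD (hf m1) -?mcoeff_msupp // (hg m2) -?mcoeff_msupp.
Qed.

Lemma zhomogMl e1 e2 e f g : zhomog e1 f -> zhomog e2 g -> e = e1 + e2 -> zhomog e (f * g).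
Proof. by move=> ? ? ->; exact: zhomogM. Qed.

Lemma zhomogX m : zhomog (mdeg m)%:Z ('X_[m] : S).
Proof. by rewrite /= dhomogX. Qed.

Lemma zhomogXU (j : 'I_n) : zhomog 1 ('X_j : S).
Proof. by rewrite -[1]/(1%:Z) -(mdeg1 j); exact: zhomogX. Qed.

Lemma zhomogC c : zhomog 0 (c%:MP : S).
Proof.
apply/zhomogP => m; rewrite mcoeffC; case: (m =P 0%MM) => [->|_]; first by rewrite mdeg0.
by rewrite mulr0 eqxx.
Qed.

Lemma zhomog_const f : zhomog 0 f -> f = (f@_0%MM)%:MP.
Proof.
move=> hf; apply/mpolyP => m; rewrite mcoeffC.
case: eqP => [->|/eqP nz]; first by rewrite mulr1.
rewrite mulr0; apply: (zhomog_nz hf).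
by apply: contra nz => /eqP [] /eqP; rewrite mdeg_eq0.
Qed.

Lemma zhomog_coef0 e f : zhomog e f -> e != 0 -> f@_0%MM = 0.
Proof. by move=> hf ne; apply: (zhomog_nz hf); rewrite mdeg0 eq_sym. Qed.

Definition zproj (e : int) f : S :=
  mpoly_of (fun m => if (mdeg m)%:Z == e then f@_m else 0) (msize f).

Lemma mcoeff_zproj e f m : (zproj e f)@_m = if (mdeg m)%:Z == e then f@_m else 0.
Proof. by rewrite mcoeff_mpoly_of // => m' /mcoeff_ge ->; case: ifP. Qed.

Lemma zproj_homog e f : zhomog e (zproj e f).
Proof. by apply/zhomogP => m; rewrite mcoeff_zproj; case: (_ =P e) => // _; rewrite eqxx. Qed.

Lemma zproj_id e f : zhomog e f -> zproj e f = f.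
Proof.
move=> hf; apply/mpolyP => m; rewrite mcoeff_zproj; case: ifP => // /negbT h.
by rewrite (zhomog_nz hf h).
Qed.

Lemma zprojD e f g : zproj e (f + g) = zproj e f + zproj e g.
Proof.
apply/mpolyP => m; rewrite mcoeffD !mcoeff_zproj mcoeffD.
by case: ifP; rewrite ?addr0.
Qed.

Lemma zproj0 e : zproj e 0 = 0.
Proof. by apply/mpolyP => m; rewrite mcoeff_zproj mcoeff0 if_same. Qed.

Lemma zproj_sum e (I : Type) (r : seq I) (F : I -> S) :
  zproj e (\sum_(i <- r) F i) = \sum_(i <- r) zproj e (F i).
Proof. by elim/big_rec2: _ => [|i x y _ <-]; rewrite ?zproj0 ?zprojD. Qed.

Lemma zproj_mulX e m c f : zproj e ((c *: 'X_[m]) * f) = (c *: 'X_[m]) * zproj (e - (mdeg m)%:Z) f.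
Proof.
rewrite -!scalerAl.
apply/mpolyP => m'; rewrite mcoeff_zproj !mcoeffZ ![_ * f]mulrC [_ * zproj _ _]mulrC.
case: (boolP (m <= m')%MM) => [le|nle].
  rewrite -(submK le) addmC !mcoeffMX mcoeff_zproj mdegD.
  have -> : ((mdeg (m' - m)%MM)%:Z == e - (mdeg m)%:Z) =
      ((mdeg m + mdeg (m' - m)%MM)%:Z == e) by lia.
  by case: ifP; rewrite // mulr0.
have h g : (g * 'X_[m])@_m' = 0.
  apply: memN_msupp_eq0; rewrite (perm_mem (msuppMX g m)).
  by apply: contra nle => /mapP [m0 _ ->]; rewrite lem_addr.
by rewrite !h mulr0 if_same.
Qed.

Lemma zproj_mull e e' f g : zhomog e' f -> zproj e (f * g) = f * zproj (e - e') g.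
Proof.
move=> /zhomogP hf; rewrite [f]mpolyE !mulr_suml zproj_sum.
rewrite big_seq [RHS]big_seq; apply: eq_bigr => m hm.
by rewrite zproj_mulX (hf m) // -mcoeff_msupp.
Qed.

Lemma zproj_mulr e e' f g : zhomog e' f -> zproj e (g * f) = zproj (e - e') g * f.
Proof. by move=> hf; rewrite mulrC (zproj_mull e g hf) mulrC. Qed.

(** The quotient of f by the variable x_j, dropping the monomials without x_j. *)
Definition xdiv (j : 'I_n) f : S := mpoly_of (fun m => f@_(m + U_(j))%MM) (msize f).

Lemma mcoeff_xdiv j f m : (xdiv j f)@_m = f@_(m + U_(j))%MM.
Proof.
rewrite mcoeff_mpoly_of // => m' h; apply: mcoeff_ge.
by rewrite mdegD; apply: leq_trans h (leq_addr _ _).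
Qed.

Lemma zhomog_xdiv j e f : zhomog e f -> zhomog (e - 1) (xdiv j f).
Proof.
move=> /zhomogP h; apply/zhomogP => m; rewrite mcoeff_xdiv => /h <-.
by rewrite mdegD mdeg1 PoszD addrK.
Qed.

Lemma mcoeff_mulXU j f m : ('X_j * f)@_m = if m j == 0%N then 0 else f@_(m - U_(j))%MM.
Proof.
rewrite mulrC; case: eqP => [e|/eqP nz].
  apply: memN_msupp_eq0; rewrite (perm_mem (msuppMX f _)).
  apply/mapP => -[m0 _ em]; move: e; rewrite em mnmDE mnm1E eqxx.
  by rewrite add1n.
have le : (U_(j) <= m)%MM by rewrite lep1mP.
by rewrite -{1}(submK le) addmC mcoeffMX.
Qed.

Lemma mcoeff_mulXU_add j f m : ('X_j * f)@_(m + U_(j))%MM = f@_m.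
Proof. by rewrite mulrC addmC mcoeffMX. Qed.

(** Membership in the ideal generated by the variables of js, read off the
    monomials. *)
Definition in_vars (js : seq 'I_n) f : Prop :=
  forall m, f@_m != 0 -> exists2 j, j \in js & m j != 0%N.

Lemma in_varsX js j f : j \in js -> in_vars js ('X_j * f).
Proof.
move=> hj m; rewrite mcoeff_mulXU; case: (m j =P 0%N) => [_|/eqP]; first by rewrite eqxx.
by exists j.
Qed.

Lemma in_vars_all f : f@_0%MM = 0 -> in_vars (enum 'I_n) f.
Proof.
move=> h m hm; have : m != 0%MM by apply: contra hm => /eqP ->; rewrite h.
move=> nz; have /existsP [j hj] : [exists j, m j != 0%N].
  apply: contraNT nz; rewrite negb_exists => /forallP hz.
  by apply/eqP/mnmP => j; rewrite mnm0E; apply/eqP; rewrite -[_ == _]negbK hz.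
by exists j; rewrite ?mem_enum.
Qed.

End Poly.

Section Vec.
Variables (k : fieldType) (n : nat).
Local Notation S := {mpoly k[n]}.

Definition vhomog (r : nat) (s : 'I_r -> int) (a : int) (v : 'rV[S]_r) : Prop :=
  forall j, zhomog (a - s j) (v 0 j).

Definition vars (js : seq 'I_n) : seq S := [seq 'X_j | j <- js].

Variables (r : nat) (s : 'I_r -> int).

Lemma vhomog_graded js : graded_sub (vars js) (vhomog s).
Proof.
split=> [a j|a u v hu hv j|a x v /mapP [i _ ->] hv j].
- by rewrite mxE; exact: zhomog0.
- by rewrite !mxE; exact: zhomogB.
- rewrite mxE; apply: (zhomogMl (zhomogXU _ i) (hv j)).
  by rewrite addrAC addrC.
Qed.

(** Dividing successively by the variables gives the coefficients. *)
Lemma ideal_part_vars js a (v : 'rV[S]_r) :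
  ideal_part (vhomog s) (vars js) a v <->
  vhomog s a v /\ forall q, in_vars js (v 0 q).
Proof.
elim: js v => [|j js IH] v /=.
  split=> [->|[_ h]].
    by split=> q; rewrite mxE; [exact: zhomog0 | move=> m; rewrite mcoeff0 eqxx].
  apply/rowP => q; rewrite mxE; apply/mpolyP => m; rewrite mcoeff0; apply/eqP.
  by apply: contraT => /h [].
split=> [[u hu /IH [h1 h2]]|[h1 h2]].
  have hXu : vhomog s a ('X_j *: u).
    have [_ _ /(_ (a - 1) 'X_j u)] := vhomog_graded [:: j].
    by rewrite subrK; apply=> //; rewrite mem_head.
  split.
    move=> q; rewrite -[v](subrK ('X_j *: u)) mxE.
    by apply: zhomogD; [exact: h1 | exact: hXu].
  move=> q m hm; have := h2 q m; rewrite !mxE mcoeffB.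
  have := @in_varsX k n (j :: js) j (u 0 q) (mem_head _ _) m.
  case: (eqVneq ('X_j * u 0 q)@_m 0) => [->|nz] h0; last by move=> _; exact: h0.
  rewrite subr0 => /(_ hm) [i hi hmi]; exists i => //.
  by rewrite inE hi orbT.
exists (\row_q xdiv j (v 0 q)).
  by move=> q; rewrite mxE addrAC; exact: zhomog_xdiv.
apply/IH; split=> q.
  rewrite !mxE; apply: zhomogB => //.
  by apply: (zhomogMl (zhomogXU _ j) (zhomog_xdiv j (h1 q))); lia.
move=> m; rewrite !mxE mcoeffB mcoeff_mulXU mcoeff_xdiv.
case: (m j =P 0%N) => [e|/eqP nz]; last first.
  by rewrite submK ?subrr ?eqxx // lep1mP.
rewrite subr0 => /h2 [i]; rewrite inE => /orP [/eqP ->|hi hm]; first by rewrite e.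
by exists i.
Qed.

(** The variables form a regular sequence on a free module: if x_j v has all its
    monomials divisible by other variables, so has v. *)
Lemma free_acyclic js : uniq js ->
  forall i a, (0 < i)%N -> kvanish (vhomog s) (@zero_gr S 'rV[S]_r) (vars js) i a.
Proof.
elim: js => [|j js IH] /= hu.
  move=> [//|i] a _ w /= -> _; exists 0 => //.
  by rewrite subr0.
case/andP: hu => nj hu; apply: acyclic_cons; [exact: vhomog_graded (j :: js)| exact: IH |].
move=> a v hv /ideal_part_vars [_ h]; apply/ideal_part_vars; split=> // q m hm.
have := h q (m + U_(j))%MM; rewrite mxE mcoeff_mulXU_add => /(_ hm) [i hi].
rewrite mnmDE mnm1E; case: (j =P i) => [e|_]; first by rewrite e hi in nj.
by rewrite addn0; exists i.
Qed.

End Vec.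

(** * Koszul homology and minimal resolutions *)

Definition vgr (k : fieldType) (n r : nat) (s : 'I_r -> int)
  (P : 'rV[{mpoly k[n]}]_r -> Prop) (a : int) (v : 'rV[{mpoly k[n]}]_r) : Prop :=
  vhomog s a v /\ P v.

Definition lin_closed (k : fieldType) (n r : nat)
    (P : 'rV[{mpoly k[n]}]_r -> Prop) : Prop :=
  [/\ P 0, forall u v, P u -> P v -> P (u - v) & forall x v, P v -> P (x *: v)].

(** P is contained in (x_1, ..., x_n) times the free module. *)
Definition no_const (k : fieldType) (n r : nat)
    (P : 'rV[{mpoly k[n]}]_r -> Prop) : Prop :=
  forall v, P v -> forall q, (v 0 q)@_0%MM = 0.

Section Step.
Variables (k : fieldType) (n : nat).
Local Notation S := {mpoly k[n]}.
Local Notation X := (vars k (enum 'I_n)).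

Definition vproj r (s : 'I_r -> int) (a : int) (v : 'rV[S]_r) : 'rV[S]_r :=
  \row_j zproj (a - s j) (v 0 j).

Lemma vproj_homog r (s : 'I_r -> int) a v : vhomog s a (vproj s a v).
Proof. by move=> j; rewrite mxE; exact: zproj_homog. Qed.

Lemma vproj_id r (s : 'I_r -> int) a v : vhomog s a v -> vproj s a v = v.
Proof. by move=> h; apply/rowP => j; rewrite mxE zproj_id. Qed.

Definition mx_graded r' r (s' : 'I_r' -> int) (s : 'I_r -> int)
  (D : 'M[S]_(r', r)) : Prop := forall p q, zhomog (s' p - s q) (D p q).

Lemma vproj_mul r' r (s' : 'I_r' -> int) (s : 'I_r -> int) D a u :
  mx_graded s' s D -> vproj s a (u *m D) = vproj s' a u *m D.
Proof.
move=> hD; apply/rowP => q; rewrite !mxE zproj_sum; apply: eq_bigr => p _.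
by rewrite mxE (zproj_mulr _ _ (hD p q)); congr (zproj _ _ * _); lia.
Qed.

Lemma vhomog_mul r' r (s' : 'I_r' -> int) (s : 'I_r -> int) D a u :
  mx_graded s' s D -> vhomog s' a u -> vhomog s a (u *m D).
Proof.
move=> hD hu q; rewrite mxE; apply: zhomog_sum => p _.
by apply: (zhomogMl (hu p) (hD p q)); lia.
Qed.

Lemma vgr_graded r (s : 'I_r -> int) P : lin_closed P -> graded_sub X (vgr s P).
Proof.
case: (vhomog_graded k s (enum 'I_n)) => h0 hB hZ [P0 PB PZ]; split.
- by move=> a; split.
- by move=> a u v [? ?] [? ?]; split; [exact: hB | exact: PB].
- by move=> a x v hx [? ?]; split; [exact: hZ | exact: PZ].
Qed.

Lemma image_closed r' r (D : 'M[S]_(r', r)) P :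
  (forall v, P v <-> exists u, v = u *m D) -> lin_closed P.
Proof.
move=> hP; split.
- by apply/hP; exists 0; rewrite mul0mx.
- by move=> _ _ /hP [u ->] /hP [v ->]; apply/hP; exists (u - v); rewrite mulmxBl.
- by move=> x _ /hP [u ->]; apply/hP; exists (x *: u); rewrite scalemxAl.
Qed.

Lemma no_const_ideal_part r (s : 'I_r -> int) P a v :
  no_const P -> vgr s P a v -> ideal_part (vhomog s) X a v.
Proof.
move=> nc [hv Pv]; apply/ideal_part_vars; split=> // q.
by apply: in_vars_all; exact: nc.
Qed.

Section OneStep.
Variables (r' r : nat) (s' : 'I_r' -> int) (s : 'I_r -> int) (D : 'M[S]_(r', r)).
Variable P : 'rV[S]_r -> Prop.
Hypothesis hD : mx_graded s' s D.
Hypothesis hP : forall v, P v <-> exists u, v = u *m D.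

Let fN a w : vhomog s' a w -> vgr s P a (mulmxr D w).
Proof.
move=> hw; split; first exact: vhomog_mul hw.
by apply/hP; exists w.
Qed.

Let Nf a v : vgr s P a v -> exists2 w, vhomog s' a w & mulmxr D w = v.
Proof.
move=> [hv /hP [u e]]; exists (vproj s' a u); first exact: vproj_homog.
by rewrite /= -(vproj_mul _ _ hD) -e vproj_id.
Qed.

Let NA a v : vgr s P a v -> vhomog s a v. Proof. by case. Qed.

Lemma syzygy_kvanish i a : (i = 0%N -> no_const P) ->
  kvanish (vhomog s) (vgr s P) X i.+1 a ->
  kvanish (vhomog s') (vgr s' (fun w => w *m D = 0)) X i a.
Proof.
move=> nc; apply: (kvanish_shift (f := mulmxr D)) => //.
- exact: vhomog_graded.
- exact: vhomog_graded.
- by apply: free_acyclic; exact: enum_uniq.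
- by move=> i0 v; apply: no_const_ideal_part; exact: nc.
Qed.

Lemma syzygy_kvanish_inv i a :
  kvanish (vhomog s') (vgr s' (fun w => w *m D = 0)) X i a ->
  kvanish (vhomog s) (vgr s P) X i.+1 a.
Proof.
apply: (kvanish_unshift (f := mulmxr D)) => //.
- exact: vhomog_graded.
- exact: vhomog_graded.
- by apply: free_acyclic; exact: enum_uniq.
Qed.
End OneStep.

(** A basis vector of degree [s j] is a nonzero class of H_0 when the relations
    have no constant terms. *)
Lemma shift_kvanish r (s : 'I_r -> int) P j :
  lin_closed P -> no_const P -> ~ kvanish (vhomog s) (vgr s P) X 0 (s j).
Proof.
move=> hP nc /(_ (kbot X (delta_mx 0 j))) [||v hv].
- apply: kgr_bot; first exact: vhomog_graded.
  move=> q; rewrite mxE eqxx /=; case: eqP => [->|_]; last exact: zhomog0.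
  by rewrite subrr; exact: zhomogC.
- rewrite (@kd_bot0 _ _ _ (vhomog s) (s j)); first by apply: kgr0; exact: vgr_graded.
  apply: kgr_bot; first exact: vhomog_graded.
  move=> q; rewrite mxE eqxx /=; case: eqP => [->|_]; last exact: zhomog0.
  by rewrite subrr; exact: zhomogC.
have [y hy ->] := kd_kgr1 hv.
rewrite -kbotB => /kgr_botE [_ /nc /(_ j)].
rewrite !mxE !eqxx mcoeffB mcoeff1 eqxx.
have /ideal_part_vars [_ /(_ j 0%MM)] := hy.
case: (eqVneq (y 0 j)@_0%MM 0) => [-> _|_ /(_ isT) [i _]]; last by rewrite mnm0E.
by move/eqP; rewrite subr0 oner_eq0.
Qed.

(** H_0 lives in the degrees of the basis: elsewhere, homogeneous vectors have no
    constant terms. *)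
Lemma no_shift_kvanish r (s : 'I_r -> int) P a :
  lin_closed P -> (forall j, s j != a) -> kvanish (vhomog s) (vgr s P) X 0 a.
Proof.
move=> hP ns w /kgr0P [v hv ->] _.
have hi : ideal_part (vhomog s) X a v.
  apply/ideal_part_vars; split=> // q; apply: in_vars_all.
  by apply: (zhomog_coef0 (hv q)); rewrite subr_eq0 eq_sym.
have [y hy ey] := ideal_part_kd (vhomog_graded k s (enum 'I_n)) hi.
exists y => //; rewrite ey subrr; apply: kgr0; exact: vgr_graded.
Qed.

End Step.

Section Resolution.
Variables (k : fieldType) (n : nat).
Local Notation S := {mpoly k[n]}.
Local Notation X := (vars k (enum 'I_n)).

Definition shift0 (_ : 'I_1) : int := 0.
Definition row_ideal (I : S -> Prop) (v : 'rV[S]_1) : Prop := I (v 0 0).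

(** Vanishing of H_i(x_1, ..., x_n; S / I) in degree a, with S seen as row vectors
    of length one so that it can be the first step of a resolution. *)
Definition ideal_kvanish (I : S -> Prop) (i : nat) (a : int) : Prop :=
  kvanish (vhomog shift0) (vgr shift0 (row_ideal I)) X i a.

Variables (I : S -> Prop) (F : free_sequence k n).
Hypothesis HF : minimal_graded_free_resolution I F.
Hypothesis I0 : forall f, I f -> f@_0%MM = 0.

(** The kernel of the map that leaves F_i. *)
Definition syz i : 'rV[S]_(rk F i) -> Prop :=
  match i with
  | 0%N => fun w => w *m aug F = 0
  | i'.+1 => fun w => w *m diff F i' = 0
  end.

Lemma syzP i v : syz v <-> exists u, v = u *m diff F i.
Proof. by case: HF => _ [_ h0 hS] _; case: i v. Qed.

Lemma syz_closed i : lin_closed (@syz i).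
Proof. exact: image_closed (@syzP i). Qed.

Lemma syz_no_const i : no_const (@syz i).
Proof.
move=> v /syzP [u ->] q; case: HF => _ _ hm.
rewrite mxE raddf_sum big1 // => p _ /=.
by rewrite (rmorphM (mcoeff 0%MM)) /= hm mulr0.
Qed.

Lemma row_idealP v : row_ideal I v <-> exists u, v = u *m aug F.
Proof.
case: HF => _ [h _ _] _; rewrite /row_ideal h; split=> -[u e]; exists u.
  by apply/rowP => q; rewrite !ord1.
by rewrite e.
Qed.

Lemma aug_graded : mx_graded (@shift _ _ F 0) shift0 (aug F).
Proof. by case: HF => -[h _] _ _ p q; rewrite ord1 subr0. Qed.

Lemma diff_graded i : mx_graded (@shift _ _ F i.+1) (@shift _ _ F i) (diff F i).
Proof. by case: HF => -[_ h] _ _ p q; exact: h. Qed.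

(** Iterated dimension shifting: H_j of the cokernel of F_(i+1) -> F_i is
    H_(i+1+j) of S / I. *)
Lemma syz_kvanish i j a : ideal_kvanish I (i.+1 + j) a ->
  kvanish (vhomog (@shift _ _ F i)) (vgr (@shift _ _ F i) (@syz i)) X j a.
Proof.
elim: i j => [|i IH] j H.
  apply: (syzygy_kvanish aug_graded row_idealP) H => _.
  by move=> v hv q; rewrite ord1; exact: I0.
apply: (syzygy_kvanish (@diff_graded i) (@syzP i)); first by move=> _; exact: syz_no_const.
by apply: IH; rewrite addnS.
Qed.

Lemma syz_kvanish_inv i j a :
  kvanish (vhomog (@shift _ _ F i)) (vgr (@shift _ _ F i) (@syz i)) X j a ->
  ideal_kvanish I (i.+1 + j) a.
Proof.
elim: i j => [|i IH] j H.
  exact: (syzygy_kvanish_inv aug_graded row_idealP).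
rewrite addSnnS; apply: IH.
exact: (syzygy_kvanish_inv (@diff_graded i) (@syzP i)).
Qed.

(** For j = 0, dimension shifting identifies the degrees of the basis of F_i with
    those in which H_(i+1)(S / I) is nonzero. Hence the shifts in F_i are at most
    c + i + 1, and one nonzero class in degree c + (e + 1) of H_(e+1) makes this
    bound attained in F_e. *)
Lemma regularity_of_kvanish (c : int) (e : nat) :
  (forall i a, c + i%:Z < a -> ideal_kvanish I i a) ->
  ~ ideal_kvanish I e.+1 (c + e.+1%:Z) ->
  is_sup (fun z => exists i (j : 'I_(rk F i)), z = shift j - i%:Z) (c + 1).
Proof.
move=> up low; split=> [z [i [j ->]]|u hu].
  case: (lerP (shift j - i%:Z) (c + 1)) => // lt; exfalso.
  apply: (@shift_kvanish k n _ (@shift _ _ F i) (@syz i) j (@syz_closed i) (@syz_no_const i)).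
  by apply: syz_kvanish; apply: up; rewrite addn0 intS; lia.
have [[j /eqP hj]|no] := classic (exists j, @shift _ _ F e j == c + e.+1%:Z).
  have := hu _ (ex_intro _ e (ex_intro _ j erefl)).
  by rewrite hj intS; lia.
case: low; rewrite -[e.+1]addn0; apply: syz_kvanish_inv.
apply: no_shift_kvanish; first exact: syz_closed.
by move=> j; apply/negP => hj; apply: no; exists j; rewrite addn0 in hj.
Qed.

End Resolution.

(** * Existence of minimal graded free resolutions *)

Lemma ex_least (Q : nat -> Prop) : (exists n, Q n) ->
  exists2 n, Q n & forall m, (m < n)%N -> ~ Q m.
Proof.
move=> [n]; elim/ltn_ind: n => n IH hn.
have [[m hm qm]|no] := classic (exists2 m, (m < n)%N & Q m); first exact: IH qm.
by exists n => // m hm qm; apply: no; exists m.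
Qed.

(** Induction step for submodules Q: elements of (l) N are reached from lower
    degree. *)
Lemma ideal_part_closed (R : comNzRingType) (V : lmodType R)
    (N : int -> V -> Prop) (Q : V -> Prop) (l : seq R) a v :
  Q 0 -> (forall u w, Q u -> Q w -> Q (u - w)) -> (forall x w, Q w -> Q (x *: w)) ->
  (forall u, N (a - 1) u -> Q u) -> ideal_part N l a v -> Q v.
Proof.
move=> Q0 QB QZ hN; elim: l v => [|x l IH] v /=; first by move=> ->.
move=> [u hu /IH hq]; rewrite -[v](subrK (x *: u)) -[x *: u in X in _ + X]opprK.
by apply: QB => //; rewrite -scaleNr; apply: QZ; exact: hN.
Qed.

Section Generation.
Variables (k : fieldType) (n : nat).
Local Notation S := {mpoly k[n]}.
Local Notation X := (vars k (enum 'I_n)).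

(** Subspaces on which finitely many coefficients detect zero are finite
    dimensional: each detecting coefficient costs at most one generator. Spanning
    is expressed through the submodules Q containing gs, which avoids handling
    coefficients. *)
Lemma finite_span r (cs : seq ('I_r * 'X_{1..n})) (U : 'rV[S]_r -> Prop) :
  (forall u v c, U u -> U v -> U (u - c%:MP *: v)) ->
  (forall u, U u -> (forall c, c \in cs -> (u 0 c.1)@_c.2 = 0) -> u = 0) ->
  exists2 gs : seq 'rV[S]_r, (forall g, g \in gs -> U g) &
    forall Q, lin_closed Q -> (forall g, g \in gs -> Q g) -> forall v, U v -> Q v.
Proof.
elim: cs U => [|c cs IH] U UB hU.
  exists [::] => // Q [Q0 _ _] _ v /hU -> //.
pose U' u := U u /\ (u 0 c.1)@_c.2 = 0.
have [|u [hu cu] h|gs hgs gen] := IH U'.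
- move=> u v x [hu cu] [hv cv]; split; first exact: UB.
  by rewrite !mxE mcoeffB mcoeffCM cu cv mulr0 subr0.
- by apply: hU => // d; rewrite inE => /orP [/eqP ->|/h].
have [[u0 hu0 nz]|no] := classic (exists2 u0, U u0 & (u0 0 c.1)@_c.2 != 0); last first.
  exists gs; first by move=> g /hgs [].
  move=> Q hQ Qgs v hv; apply: gen => //; split=> //; apply/eqP/negPn/negP => h.
  by apply: no; exists v.
exists (u0 :: gs) => [g|Q hQ Qgs v hv].
  by rewrite inE => /orP [/eqP ->|/hgs []].
pose x := (v 0 c.1)@_c.2 / (u0 0 c.1)@_c.2.
have hQ' : Q (v - x%:MP *: u0).
  apply: gen => //; first by move=> g hg; apply: Qgs; rewrite inE hg orbT.
  split; first exact: UB.
  by rewrite !mxE mcoeffB mcoeffCM divfK // subrr.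
case: hQ => _ QB QZ.
rewrite -[v](subrK (x%:MP *: u0)) -[x%:MP *: u0 in X in _ + X]opprK; apply: QB => //.
by rewrite -scaleNr; apply: QZ; apply: Qgs; rewrite mem_head.
Qed.

Variables (r : nat) (s : 'I_r -> int) (P : 'rV[S]_r -> Prop).
Hypothesis hP : lin_closed P.
Hypothesis Pnc : no_const P.
Hypothesis Pproj : forall a v, P v -> P (vproj s a v).

Lemma degree_span (a : int) :
  exists2 gs : seq 'rV[S]_r, (forall g, g \in gs -> vgr s P a g) &
    forall Q, lin_closed Q -> (forall g, g \in gs -> Q g) ->
      forall v, vgr s P a v -> Q v.
Proof.
pose b := (\max_q `|(a - s q)%R|%N).+1.
apply: (@finite_span r [seq (q, bmnm m) | q <- enum 'I_r, m <- enum {: 'X_{1..n < b}}]).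
  move=> u v c [hu Pu] [hv Pv]; case: hP => _ PB PZ; split; last by apply: PB => //; exact: PZ.
  move=> q; rewrite !mxE; apply: zhomogB => //.
  by apply: (zhomogMl (zhomogC n c) (hv q)); rewrite add0r.
move=> u [hu _] h; apply/rowP => q; apply/mpolyP => m; rewrite mxE mcoeff0.
apply/eqP/negPn/negP => nz.
have hm : (mdeg m < b)%N.
  have /zhomogP/(_ _ nz) e := hu q.
  by rewrite ltnS -[mdeg m]/(`|(mdeg m)%:Z|%N) e; apply: (leq_bigmax q).
move/eqP: nz; apply; apply: (h (q, m)).
apply/allpairsP; exists (q, BMultinom hm).
by rewrite !mem_enum.
Qed.

Lemma degrees_span (L : seq int) :
  exists2 gs : seq (int * 'rV[S]_r), (forall g, g \in gs -> vgr s P g.1 g.2) &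
    forall Q, lin_closed Q -> (forall g, g \in gs -> Q g.2) ->
      forall a, a \in L -> forall v, vgr s P a v -> Q v.
Proof.
elim: L => [|a L [gs h1 h2]]; first by exists [::].
have [gs' h1' h2'] := degree_span a.
exists ([seq (a, g) | g <- gs'] ++ gs) => [g|Q hQ hg b].
  rewrite mem_cat => /orP [/mapP [g' hg' ->]|/h1 //]; exact: h1'.
rewrite inE => /orP [/eqP ->|hb] v hv; last first.
  by apply: h2 hb v hv => // g hg'; apply: hg; rewrite mem_cat hg' orbT.
apply: h2' hv => // g hg'; apply: (hg (a, g)).
by rewrite mem_cat map_f.
Qed.

Lemma sum_vproj (v : 'rV[S]_r) :
  exists T : nat, v = \sum_(t < T.*2.+1) vproj s (t%:Z - T%:Z) v.
Proof.
pose T := (\max_q (`|s q|%N + msize (v 0%R q)))%N.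
exists T; apply/rowP => q; apply/mpolyP => m; rewrite summxE raddf_sum /=.
have [z|nz] := eqVneq (v 0 q)@_m 0.
  by rewrite z big1 // => t _; rewrite mxE mcoeff_zproj z if_same.
have hT : (`|s q|%N + msize (v 0%R q) <= T)%N by rewrite /T (leq_bigmax q).
have hm : (mdeg m < msize (v 0%R q))%N by rewrite msize_mdeg_lt // mcoeff_msupp.
have ht : (`|((mdeg m)%:Z + s q + T%:Z)%R| < T.*2.+1)%N by lia.
rewrite (bigD1 (Ordinal ht)) //= big1 => [|t ne].
  rewrite addr0 mxE mcoeff_zproj ifT //; lia.
rewrite mxE mcoeff_zproj ifF //; apply/negbTE; apply: contra ne => /eqP e.
by apply/eqP/val_inj => /=; lia.
Qed.

(** Each graded piece is finite dimensional, the pieces of very negative degree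
    vanish, and above B there are no new generators as H_1 vanishes there. *)
Lemma finitely_generated (B : int) :
  (forall a, B < a -> kvanish (vhomog s) (vgr s P) X 1 a) ->
  exists2 gs : seq (int * 'rV[S]_r), (forall g, g \in gs -> vgr s P g.1 g.2) &
    forall Q, lin_closed Q -> (forall g, g \in gs -> Q g.2) ->
      forall v, P v -> Q v.
Proof.
move=> van; pose T := (`|B|%N + \max_q `|s q|%N)%N.
have [gs h1 h2] := degrees_span [seq t%:Z - T%:Z | t <- iota 0 (T.*2.+1)].
exists gs => // Q hQ hg v Pv.
have [Q0 QB QZ] := hQ.
have hom (t : nat) u : vgr s P (t%:Z - T%:Z) u -> Q u.
  elim/ltn_ind: t u => t IH u hu.
  have [le|lt] := leqP t T.*2.
    by apply: (h2 _ hQ hg) hu; apply/mapP; exists t => //; rewrite mem_iota.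
  have ga : ideal_part (vgr s P) X (t%:Z - T%:Z) u.
    apply: (ideal_part_gen _ _ (A := vhomog s)) hu.
    - exact: vhomog_graded.
    - exact: vgr_graded.
    - by move=> w; exact: no_const_ideal_part.
    - by apply: van; lia.
  apply: ideal_part_closed ga => // w.
  have -> : t%:Z - T%:Z - 1 = t.-1%:Z - T%:Z by lia.
  by apply: IH; lia.
have homa a u : vgr s P a u -> Q u.
  move=> hu; have [ge|lt] := lerP (- T%:Z) a.
    have e : a = `|(a + T%:Z)%R|%N%:Z - T%:Z by lia.
    by rewrite e in hu; exact: hom hu.
  suff -> : u = 0 by [].
  apply/rowP => q; rewrite mxE; apply/mpolyP => m; rewrite mcoeff0.
  apply: (zhomog_nz (hu.1 q)).
  have : (`|s q| <= \max_q `|s q|)%N by rewrite (leq_bigmax q).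
  by rewrite /T in lt; lia.
have [T' ->] := sum_vproj v.
elim/big_rec: _ => // t w _ hw.
rewrite -[vproj _ _ _]opprK addrC; apply: QB => //.
rewrite -scaleN1r; apply: QZ; apply: (homa (t%:Z - T'%:Z)).
by split; [exact: vproj_homog | exact: Pproj].
Qed.

Definition generates r' (s' : 'I_r' -> int) (D : 'M[S]_(r', r)) : Prop :=
  mx_graded s' s D /\ forall v, P v <-> exists u, v = u *m D.

Lemma exists_generates (B : int) :
  (forall a, B < a -> kvanish (vhomog s) (vgr s P) X 1 a) ->
  exists r', exists (s' : 'I_r' -> int) D, generates s' D.
Proof.
move=> /finitely_generated [gs h1 h2].
pose D := \matrix_(i < size gs) (tnth (in_tuple gs) i).2.
exists (size gs), (fun i => (tnth (in_tuple gs) i).1), D; split.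
  move=> p q; rewrite mxE.
  by have [h _] := h1 _ (mem_tnth p (in_tuple gs)); exact: h.
have rowD p : row p D = (tnth (in_tuple gs) p).2 by rewrite rowK. 
have QD : lin_closed (fun v => exists u, v = u *m D) by apply: (@image_closed _ _ _ _ D).
move=> v; split.
  apply: (h2 _ QD) => g /seq_tnthP [p ->].
  by exists (delta_mx 0 p); rewrite -rowE rowD.
case: hP => P0 PB PZ [u ->]; rewrite mulmx_sum_row.
elim/big_rec: _ => // p w _ hw.
rewrite -[_ *: _]opprK addrC; apply: PB => //; rewrite -scaleNr; apply: PZ.
by rewrite rowD; have [] := h1 _ (mem_tnth p (in_tuple gs)).
Qed.

(** Homogeneous generators in least possible number satisfy no relation with a
    constant term, since such a relation would express one generator in terms of
    the others. *)
Lemma minimal_generates (B : int) :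
  (forall a, B < a -> kvanish (vhomog s) (vgr s P) X 1 a) ->
  exists r', exists (s' : 'I_r' -> int) D,
    generates s' D /\ no_const (fun w => w *m D = 0).
Proof.
move=> /exists_generates /ex_least [r' [s' [D [hD hPD]]] least].
exists r', s', D; split=> // w hw j; apply/eqP/negPn/negP => nz.
case: r' s' D hD hPD least w hw j nz => [|r'] s' D hD hPD least w hw j nz.
  by case: j nz.
(* In degree s' j the j-th coefficient of the relation is a nonzero constant. *)
pose c := (w 0 j)@_0%MM; pose w' := vproj s' (s' j) w.
have hw' : w' *m D = 0.
  by rewrite -(vproj_mul _ _ hD) hw; apply/rowP => q; rewrite !mxE zproj0.
have cj : w' 0 j = c%:MP.
  rewrite mxE subrr (zhomog_const (zproj_homog _ _)) mcoeff_zproj mdeg0 eqxx //.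
apply: (least r'); first exact: ltnSn.
exists (s' \o lift j), (row' j D); split.
  by move=> p q; rewrite mxE; exact: hD.
move=> v; rewrite hPD; split=> [[u ->]|[u ->]].
  pose u2 := u - (u 0 j * (c^-1)%:MP) *: w'.
  have uj : u2 0 j = 0.
    have -> : u2 0 j = u 0 j - u 0 j * (c^-1)%:MP * w' 0 j by rewrite !mxE.
    by rewrite cj -mulrA -mpolyCM mulVf // mulr1 subrr.
  have -> : u *m D = u2 *m D by rewrite mulmxBl -scalemxAl hw' scaler0 subr0.
  exists (col' j u2); apply/rowP => q; rewrite !mxE (bigD1_ord j) //= uj mul0r add0r.
  by apply: eq_bigr => p _; rewrite !mxE.
exists (\row_p (if unlift j p is Some p' then u 0 p' else 0)).
apply/rowP => q; rewrite !mxE (bigD1_ord j) //= mxE unlift_none mul0r add0r.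
by apply: eq_bigr => p _; rewrite !mxE liftK.
Qed.

End Generation.

Section Existence.
Variables (k : fieldType) (n : nat).
Local Notation S := {mpoly k[n]}.
Local Notation X := (vars k (enum 'I_n)).

(** The kernel at one step of the construction, with what is needed to go on: the
    bound on Koszul homology is what makes it finitely generated. *)
Record stage := Stage {
  st_rank : nat;
  st_shift : 'I_st_rank -> int;
  st_sub : 'rV[S]_st_rank -> Prop;
  st_closed : lin_closed st_sub;
  st_no_const : no_const st_sub;
  st_proj : forall a v, st_sub v -> st_sub (vproj st_shift a v);
  st_bounded : exists c : int, forall i a, c + i%:Z < a ->
    kvanish (vhomog st_shift) (vgr st_shift st_sub) X i a }.

Record extends (x : stage) := Extends {
  next : stage;
  next_mx : 'M[S]_(st_rank next, st_rank x);
  next_gen : generates (@st_shift x) (@st_sub x) (@st_shift next) next_mx;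
  next_sub : forall w, st_sub w <-> w *m next_mx = 0 }.

Lemma exists_extends (x : stage) : inhabited (extends x).
Proof.
case: x => r s P Pcl Pnc Ppr [c hc].
have [r' [s' [D [[hD hPD] Dnc]]]] : exists r', exists (s' : 'I_r' -> int) D,
    generates s P s' D /\ no_const (fun w => w *m D = 0).
  by apply: (minimal_generates Pcl Pnc Ppr (B := c + 1)) => a ha; apply: hc.
pose K (w : 'rV[S]_r') := w *m D = 0.
have Kcl : lin_closed K.
  split; first by rewrite /K mul0mx.
    by move=> u v; rewrite /K mulmxBl => -> ->; rewrite subrr.
  by move=> y v; rewrite /K -scalemxAl => ->; rewrite scaler0.
have Kpr a v : K v -> K (vproj s' a v).
  by rewrite /K -(vproj_mul _ _ hD) => ->; apply/rowP => q; rewrite !mxE zproj0.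
have Kb : exists c : int, forall i a, c + i%:Z < a ->
    kvanish (vhomog s') (vgr s' K) X i a.
  exists (c + 1) => i a ha; apply: (syzygy_kvanish hD hPD) => //.
  by apply: hc; rewrite intS; lia.
by split; exists (Stage Kcl Dnc Kpr Kb) D.
Qed.

Definition extend (x : stage) : extends x :=
  proj1_sig (constructive_indefinite_description (fun _ => True)
    (let: inhabits e := exists_extends x in ex_intro _ e Logic.I)).

Fixpoint iterate (x : stage) (i : nat) : stage :=
  if i is i'.+1 then next (extend (iterate x i')) else x.

(** Stage 0 is I inside S, and each later stage is the kernel of a minimal cover
    of the previous one. *)
Lemma exists_minimal_resolution (I : S -> Prop) (c : int) :
  (forall f g, I f -> I g -> I (f - g)) -> (forall f g, I g -> I (f * g)) -> I 0 ->
  (forall f, I f -> f@_0%MM = 0) -> (forall e f, I f -> I (zproj e f)) ->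
  (forall i a, c + i%:Z < a -> ideal_kvanish I i a) ->
  exists F : free_sequence k n, minimal_graded_free_resolution I F.
Proof.
move=> IB IM I0 Inc Ipr van.
have cl : lin_closed (@row_ideal k n I).
  by split=> [|u v hu hv|x v hv]; rewrite /row_ideal !mxE; [|exact: IB|exact: IM].
have nc : no_const (@row_ideal k n I) by move=> v hv q; rewrite ord1; exact: Inc.
have pr a v : row_ideal I v -> row_ideal I (vproj shift0 a v).
  by move=> hv; rewrite /row_ideal mxE; exact: Ipr.
pose x0 := Stage cl nc pr (ex_intro _ c van).
pose F := @FreeSequence k n (fun i => st_rank (iterate x0 i.+1))
  (fun i => @st_shift (iterate x0 i.+1))
  (next_mx (extend x0)) (fun i => next_mx (extend (iterate x0 i.+1))).
exists F; split.
- split.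
    move=> p; have [h _] := next_gen (extend x0).
    by have := h p 0; rewrite subr0.
  by move=> i p q; have [h _] := next_gen (extend (iterate x0 i.+1)); exact: h.
- split.
  + move=> f; have [_ h] := next_gen (extend x0).
    have := h (\row_(_ < 1) f); rewrite /= /row_ideal mxE => ->.
    split=> -[u e]; exists u; first by rewrite -e mxE.
    by apply/rowP => q; rewrite mxE ord1.
  + move=> v; have [_ h] := next_gen (extend (iterate x0 1)).
    by rewrite -(next_sub (e := extend x0)); exact: h.
  + move=> i v; have [_ h] := next_gen (extend (iterate x0 i.+2)).
    by rewrite -(next_sub (e := extend (iterate x0 i.+1))); exact: h.
- move=> i p q; have [_ h] := next_gen (extend (iterate x0 i.+1)).
  have hp : st_sub (row p (diff F i)).
    by apply/h; exists (delta_mx 0 p); rewrite -rowE.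
  by have := st_no_const hp q; rewrite mxE.
Qed.

End Existence.

(** * Arithmetic of the exponents *)

Section Arith.
Local Open Scope nat_scope.
Variables (e : nat).
Hypothesis e_gt0 : 0 < e.
Implicit Types (t x y p q s P Q : nat).

(** With e = d - 1, divisibility of a monomial with exponents t, x, y in
    x_1, x_2, x_3 by one of the monomial generators of the ideal. *)
Definition bad_exp t x y : bool :=
  [|| e < t, e < x, e < y, (0 < t) && (e <= x) | (0 < t) && (e <= y)].

(** x_2^x x_3^y x_4^p x_5^q has the invariants s, P, Q, which are unchanged when
    x_2 x_4^e is exchanged with x_3 x_5^e. *)
Definition rep s P Q x y p q : Prop :=
  [/\ x + y = s, p + e * y = P & q + e * x = Q].

(** This is d^2 - 2. *)
Definition deg_bound : nat := e * e + 2 * e - 1.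

Lemma good_degree t x y : ~~ bad_exp t x y -> t + x + y <= deg_bound.
Proof. rewrite /bad_exp /deg_bound => h; nia. Qed.

(** A class that avoids the monomial generators but meets them after
    multiplication by x_4 and also by x_5. The bad monomials are then the two
    ends of the enlarged chains of exchanges, which forces y1 and x2 to be the
    least forbidden exponent and determines P and Q. *)
Lemma socle_degree t s P Q x0 y0 p0 q0 x1 y1 p1 q1 x2 y2 p2 q2 :
  rep s P Q x0 y0 p0 q0 ->
  (forall x y p q, rep s P Q x y p q -> ~~ bad_exp t x y) ->
  rep s P.+1 Q x1 y1 p1 q1 -> bad_exp t x1 y1 ->
  rep s P Q.+1 x2 y2 p2 q2 -> bad_exp t x2 y2 ->
  t + x0 + y0 + p0 + q0 <= deg_bound.
Proof.
move=> [a0 b0 c0] good [a1 b1 c1] bad1 [a2 b2 c2] bad2.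
have {}b1 : e * y1 = P.+1.
  case: p1 b1 => [|p1] b1; first by [].
  by have /negP : ~~ bad_exp t x1 y1 by apply: (good _ _ p1 q1); split; lia.
have {}c2 : e * x2 = Q.+1.
  case: q2 c2 => [|q2] c2; first by [].
  by have /negP : ~~ bad_exp t x2 y2 by apply: (good _ _ p2 q2); split; lia.
have l1 : x1 < x2 by nia.
have l2 : x0 < x2 by nia.
have l3 : y0 < y1 by nia.
have l4 : x1.+2 <= x2 by lia.
have l5 : 0 < y1 by lia.
have g1 : ~~ bad_exp t x1.+1 y1.-1 by apply: (good _ _ (e - 1) (Q - e * x1.+1)); split; nia.
have g2 : ~~ bad_exp t x2.-1 y2.+1 by apply: (good _ _ (P - e * y2.+1) (e - 1)); split; nia.
have deg : t + x0 + y0 + p0 + q0 + e * s = t + s + P + Q by nia.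
have l6 : x1 <= e * x1 by rewrite leq_pmull.
case: (posnP t) => [t0|t0].
  have hy : y1 = e.+1 by move: g1 bad1; rewrite /bad_exp; lia.
  have hx : x2 = e.+1 by move: g2 bad2; rewrite /bad_exp; lia.
  have hs : e * s = e * x1 + e * e + e by rewrite -a1 hy mulnDr mulnS; lia.
  by move: b1 c2; rewrite hy hx mulnS /deg_bound; lia.
have hy : y1 = e by move: g1 bad1; rewrite /bad_exp; lia.
have hx : x2 = e by move: g2 bad2; rewrite /bad_exp; lia.
have ht : t <= e by move: g1; rewrite /bad_exp; lia.
have hs : e * s = e * x1 + e * e by rewrite -a1 hy mulnDr.
by move: b1 c2; rewrite hy hx /deg_bound; lia.
Qed.

(** A monomial x_2^x x_3^y without x_4 and x_5 admits no exchange, so that a class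
    which contains a multiple of x_4 x_5 consists of multiples of x_4 or x_5. *)
Lemma join_good t s P Q x0 y0 p0 q0 :
  rep s P Q x0 y0 p0 q0 ->
  (forall x y p q, rep s P.+1 Q x y p q -> ~~ bad_exp t x y) ->
  (forall x y p q, rep s P Q.+1 x y p q -> ~~ bad_exp t x y) ->
  forall x y p q, rep s P.+1 Q.+1 x y p q -> ~~ bad_exp t x y.
Proof.
move=> [a0 b0 c0] g1 g2 x y p q [a b c].
case: p b => [|p] b; last by apply: (g2 _ _ p q); split; lia.
case: q c => [|q] c; last by apply: (g1 _ _ 0 q); split; lia.
have : x0 < x by nia.
have : y0 < y by nia.
lia.
Qed.

(** No monomial of the class is divisible by x_5, so no exchange introduces
    x_5^e: either p0 < e, and the degree is small, or x0 = 0, and then the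
    class stays a single power of x_3 times a power of x_4. *)
Lemma no_w_good t s P Q x0 y0 p0 q0 :
  rep s P Q x0 y0 p0 q0 ->
  (forall x y p q, rep s P Q x y p q -> ~~ bad_exp t x y) ->
  (forall x y p q, rep s P Q x y p q -> q = 0) ->
  deg_bound < t + x0 + y0 + p0 + q0 ->
  forall x y p q, rep s P.+1 Q x y p q -> ~~ bad_exp t x y /\ q = 0.
Proof.
move=> r0 g noq lt x y p q [a b c].
have q0_ := noq _ _ _ _ r0; have g0 := g _ _ _ _ r0; case: r0 => a0 b0 c0.
have x00 : x0 = 0.
  apply/eqP; rewrite -leqn0 leqNgt; apply/negP => x0_gt.
  have [le|lt'] := leqP e p0.
    have : e = 0 by apply: (noq x0.-1 y0.+1 (p0 - e) e); split; nia.
    lia.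
  by move: g0 lt; rewrite /bad_exp /deg_bound; nia.
have : x = 0 /\ q = 0 by nia.
move=> [-> ->]; split=> //.
have -> : y = y0 by lia.
by rewrite x00 in g0.
Qed.

Lemma no_z_good t s P Q x0 y0 p0 q0 :
  rep s P Q x0 y0 p0 q0 ->
  (forall x y p q, rep s P Q x y p q -> ~~ bad_exp t x y) ->
  (forall x y p q, rep s P Q x y p q -> p = 0) ->
  deg_bound < t + x0 + y0 + p0 + q0 ->
  forall x y p q, rep s P Q.+1 x y p q -> ~~ bad_exp t x y /\ p = 0.
Proof.
have repC s' P' Q' x y p q : rep s' P' Q' x y p q -> rep s' Q' P' y x q p.
  by case=> a b c; split=> //; rewrite addnC.
have badC x y : bad_exp t x y = bad_exp t y x by rewrite /bad_exp; lia.
move=> hr good nop lt x y p q /repC hr'; rewrite badC.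
apply: (no_w_good (repC _ _ _ _ _ _ _ hr) _ _ _ hr') => [||]; last by lia.
  by move=> ? ? ? ? /repC /good; rewrite badC.
by move=> ? ? ? ? /repC /nop.
Qed.

End Arith.

(** * The ideal in terms of class sums *)

Lemma ideal_gen_closed (R : comNzRingType) (s : seq R) :
  [/\ ideal_gen s 0, forall f g, ideal_gen s f -> ideal_gen s g -> ideal_gen s (f - g)
    & forall f g, ideal_gen s g -> ideal_gen s (f * g)].
Proof.
split.
- by exists (fun _ => 0); rewrite big1 // => i _; rewrite mul0r.
- move=> _ _ [c ->] [c' ->]; exists (fun i => c i - c' i).
  by rewrite -sumrB; apply: eq_bigr => i _; rewrite mulrBl.
- move=> f _ [c ->]; exists (fun i => f * c i).
  by rewrite mulr_sumr; apply: eq_bigr => i _; rewrite mulrA.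
Qed.

Lemma ideal_gen_mem (R : comNzRingType) (s : seq R) g : g \in s -> ideal_gen s g.
Proof.
move=> /seq_tnthP [i ->]; exists (fun j => (j == i)%:R).
rewrite (bigD1 i) //= eqxx mul1r big1 ?addr0 => [|j /negbTE ->]; last by rewrite mul0r.
by rewrite (tnth_nth 0).
Qed.

Lemma ideal_gen_ind (R : comNzRingType) (s : seq R) (Q : R -> Prop) :
  Q 0 -> (forall f g, Q f -> Q g -> Q (f + g)) ->
  (forall c g, g \in s -> Q (c * g)) -> forall f, ideal_gen s f -> Q f.
Proof.
move=> Q0 QD QM _ [c ->]; elim/big_rec: _ => // i f _ hf; apply: QD => //.
by apply: QM; rewrite mem_nth.
Qed.

Section Monomials.
Local Open Scope nat_scope.
Notation ix j := (inord j : 'I_5).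

Definition mon (t x y p q : nat) : 'X_{1..5} :=
  [multinom nth 0 [:: t; x; y; p; q] i | i < 5].

Lemma monE t x y p q :
  (mon t x y p q (ix 0) = t) * (mon t x y p q (ix 1) = x) * (mon t x y p q (ix 2) = y) *
  (mon t x y p q (ix 3) = p) * (mon t x y p q (ix 4) = q).
Proof. by do !split; rewrite mnmE inordK. Qed.

Lemma enum5 : enum 'I_5 = [:: ix 0; ix 1; ix 2; ix 3; ix 4].
Proof.
by apply: (inj_map val_inj); rewrite val_enum_ord /= !inordK.
Qed.

Lemma mon_eta (m : 'X_{1..5}) : m = mon (m (ix 0)) (m (ix 1)) (m (ix 2)) (m (ix 3)) (m (ix 4)).
Proof.
apply/mnmP => i; have : i \in enum 'I_5 by rewrite mem_enum.
rewrite enum5 !inE => /orP[|/orP[|/orP[|/orP[|]]]] /eqP ->; by rewrite monE.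
Qed.

Lemma mdeg_mon t x y p q : mdeg (mon t x y p q) = t + x + y + p + q.
Proof.
 rewrite mdegE -big_enum enum5 !big_cons big_nil !monE. by rewrite /= addn0 !addnA.
Qed.

Lemma monD t x y p q t' x' y' p' q' :
  (mon t x y p q + mon t' x' y' p' q')%MM = mon (t + t') (x + x') (y + y') (p + p') (q + q').
Proof. by rewrite [LHS]mon_eta !mnmDE !monE. Qed.

Lemma monX t x y p q n :
  (mon t x y p q *+ n)%MM = mon (t * n) (x * n) (y * n) (p * n) (q * n).
Proof. by rewrite [LHS]mon_eta !mulmnE !monE. Qed.

Lemma U_mon : (U_(ix 0) = mon 1 0 0 0 0)%MM * (U_(ix 1) = mon 0 1 0 0 0)%MM *
  (U_(ix 2) = mon 0 0 1 0 0)%MM * (U_(ix 3) = mon 0 0 0 1 0)%MM *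
  (U_(ix 4) = mon 0 0 0 0 1)%MM.
Proof.
by do !split; rewrite [LHS]mon_eta !mnm1E -!(inj_eq val_inj) /= !inordK.
Qed.

End Monomials.

Section Ideal.
Variables (k : fieldType) (e : nat).
Hypothesis e_gt0 : (0 < e)%N.
Local Notation S := {mpoly k[5]}.
Notation ix j := (inord j : 'I_5).
Local Notation I := (@the_ideal k e.+1).
Local Notation bad t x y := (bad_exp e t x y).

(** The exponents of the image of a monomial under the Rees map
    x_2 -> T b^e, x_3 -> T a^e, x_4 -> a, x_5 -> b, x_1 -> x_1, whose kernel is
    generated by x_2 x_4^e - x_3 x_5^e. The monomials with a given key form a
    class. *)
Definition key (m : 'X_{1..5}) : nat * nat * nat * nat :=
  (m (ix 0), m (ix 1) + m (ix 2), m (ix 3) + e * m (ix 2), m (ix 4) + e * m (ix 1))%N.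

Definition bad_mon (m : 'X_{1..5}) : bool := bad (m (ix 0)) (m (ix 1)) (m (ix 2)).

(** Modulo the ideal, the monomials of an alive class are all equal and nonzero;
    those of any other class vanish. *)
Definition alive (c : nat * nat * nat * nat) : Prop :=
  (exists m, key m = c) /\ forall m, key m = c -> ~~ bad_mon m.

(** The coefficient at c of the image of f under the Rees map. *)
Definition csum (c : nat * nat * nat * nat) (f : S) : k :=
  \sum_(m <- msupp f) f@_m * (key m == c)%:R.

Lemma csumE c f b : (msize f <= b)%N ->
  csum c f = \sum_(m : 'X_{1..5 < b}) f@_m * (key m == c)%:R.
Proof.
move=> le; pose J : subFinType _ := 'X_{1..5 < b}.
rewrite /csum (big_mksub J) ?msupp_uniq //=; first last.
  by move=> x /msize_mdeg_lt /leq_trans; apply.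
by rewrite big_rmcond //= => j /memN_msupp_eq0 ->; rewrite mul0r.
Qed.

Lemma csum_linear c : linear_for *%R (csum c).
Proof.
move=> a f g; pose b := maxn (msize (a *: f + g)) (maxn (msize f) (msize g)).
rewrite !(@csumE c _ b) /b ?leq_max ?leqnn ?orbT //.
rewrite mulr_sumr -big_split; apply: eq_bigr => m _ /=.
by rewrite mcoeffD mcoeffZ mulrDl mulrA.
Qed.

HB.instance Definition _ c := GRing.isLinear.Build k S k *%R (csum c) (csum_linear c).

Lemma csumX c m : csum c 'X_[m] = (key m == c)%:R.
Proof. by rewrite /csum msuppX big_seq1 mcoeffX eqxx mul1r. Qed.

Lemma csum_neq0 c f : csum c f != 0 -> exists2 m, f@_m != 0 & key m = c.
Proof.
move=> nz; apply: NNPP => no; move/eqP: nz; apply.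
rewrite /csum big_seq big1 // => m; rewrite mcoeff_msupp => hm.
by case: eqP => [h|]; [case: no; exists m | rewrite mulr0].
Qed.

Lemma csumMX c m0 f :
  csum c ('X_[m0] * f) = \sum_(m <- msupp f) f@_m * (key (m0 + m)%MM == c)%:R.
Proof.
rewrite {1}[f]mpolyE mulr_sumr raddf_sum; apply: eq_bigr => m _ /=.
by rewrite -scalerAr linearZ /= -mpolyXD csumX.
Qed.

Lemma key_mon t x y p q : key (mon t x y p q) = (t, x + y, p + e * y, q + e * x)%N.
Proof. by rewrite /key !monE. Qed.

Lemma csum_z t s P Q f : csum (t, s, P.+1, Q) ('X_(ix 3) * f) = csum (t, s, P, Q) f.
Proof.
rewrite csumMX; apply: eq_bigr => m _; congr (_ * (nat_of_bool _)%:R).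
by rewrite U_mon [in LHS](mon_eta m) monD key_mon /key !add0n add1n addSn; apply/eqP/eqP => -[-> -> <- ->].
Qed.

Lemma csum_z0 t s Q f : csum (t, s, 0%N, Q) ('X_(ix 3) * f) = 0.
Proof.
rewrite csumMX big1 // => m _; rewrite U_mon (mon_eta m) monD key_mon.
by case: eqP; rewrite ?mulr0 // add1n addSn.
Qed.

Lemma csum_w t s P Q f : csum (t, s, P, Q.+1) ('X_(ix 4) * f) = csum (t, s, P, Q) f.
Proof.
rewrite csumMX; apply: eq_bigr => m _; congr (_ * (nat_of_bool _)%:R).
by rewrite U_mon [in LHS](mon_eta m) monD key_mon /key !add0n add1n addSn; apply/eqP/eqP => -[-> -> -> <-].
Qed.

Lemma csum_w0 t s P f : csum (t, s, P, 0%N) ('X_(ix 4) * f) = 0.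
Proof.
rewrite csumMX big1 // => m _; rewrite U_mon (mon_eta m) monD key_mon.
by case: eqP; rewrite ?mulr0 // add1n addSn.
Qed.

Definition gens : seq S :=
  [:: 'X_[mon e.+1 0 0 0 0]; 'X_[mon 0 e.+1 0 0 0]; 'X_[mon 0 0 e.+1 0 0];
      'X_[mon 1 e 0 0 0]; 'X_[mon 1 0 e 0 0];
      'X_[mon 0 1 0 e 0] - 'X_[mon 0 0 1 0 e]].

Lemma the_idealE f : I f = ideal_gen gens f.
Proof.
rewrite /the_ideal /var /= !mpolyXn -!mpolyXD !U_mon !monX !monD.
by rewrite !mul0n !mul1n !add0n !addn0.
Qed.

Lemma gens_homog g : g \in gens -> zhomog e.+1%:Z g.
Proof.
have h m : mdeg m = e.+1 -> zhomog e.+1%:Z ('X_[m] : S) by move=> <-; exact: zhomogX.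
rewrite !inE => /orP[|/orP[|/orP[|/orP[|/orP[|]]]]] /eqP ->; last first.
  by apply: zhomogB; apply: h; rewrite mdeg_mon; lia.
all: by apply: h; rewrite mdeg_mon; lia.
Qed.

Lemma ideal0 : I 0.
Proof. by rewrite the_idealE; case: (ideal_gen_closed gens). Qed.
Lemma idealB f g : I f -> I g -> I (f - g).
Proof. by rewrite !the_idealE; case: (ideal_gen_closed gens) => _ h _; exact: h. Qed.
Lemma idealM f g : I g -> I (f * g).
Proof. by rewrite !the_idealE; case: (ideal_gen_closed gens) => _ _ h; exact: h. Qed.
Lemma idealD f g : I f -> I g -> I (f + g).
Proof.
move=> hf hg; rewrite -[g]opprK; apply: idealB => //; rewrite -sub0r.
by apply: idealB => //; exact: ideal0.
Qed.
Lemma idealZ c f : I f -> I (c *: f).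
Proof. by move=> hf; rewrite -mul_mpolyC; exact: idealM. Qed.
Lemma ideal_sum (T : eqType) (r : seq T) (F : T -> S) :
  (forall i, i \in r -> I (F i)) -> I (\sum_(i <- r) F i).
Proof.
move=> h; rewrite big_seq; elim/big_rec: _ => [|i f hi hf]; first exact: ideal0.
by apply: idealD => //; exact: h.
Qed.

Lemma ideal_no_const f : I f -> f@_0%MM = 0.
Proof.
rewrite the_idealE; apply: (ideal_gen_ind (Q := fun f => f@_0%MM = 0)).
- exact: mcoeff0.
- by move=> g h hg hh; rewrite mcoeffD hg hh addr0.
- move=> c g /gens_homog hg; rewrite (rmorphM (mcoeff 0%MM)) /=.
  by rewrite (zhomog_coef0 hg) ?mulr0.
Qed.

Lemma ideal_zproj a f : I f -> I (zproj a f).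
Proof.
rewrite [I f]the_idealE; apply: (ideal_gen_ind (Q := fun f => I (zproj a f))).
- by rewrite zproj0; exact: ideal0.
- by move=> g h hg hh; rewrite zprojD; exact: idealD.
- move=> c g hg; rewrite (zproj_mulr _ _ (gens_homog hg)); apply: idealM.
  by rewrite the_idealE; exact: ideal_gen_mem.
Qed.

Lemma bad_mon_ideal m : bad_mon m -> I 'X_[m].
Proof.
have sub m0 : 'X_[m0] \in gens -> (m0 <= m)%MM -> I 'X_[m].
  move=> hg le; rewrite -(submK le) mpolyXD; apply: idealM.
  by rewrite the_idealE; exact: ideal_gen_mem.
have le t x y : (t <= m (ix 0))%N -> (x <= m (ix 1))%N -> (y <= m (ix 2))%N ->
    (mon t x y 0 0 <= m)%MM.
  move=> ht hx hy; apply/mnm_lepP => i.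
  have : i \in enum 'I_5 by rewrite mem_enum.
  by rewrite enum5 !inE => /orP[|/orP[|/orP[|/orP[|]]]] /eqP ->; rewrite monE.
rewrite /bad_mon /bad_exp => /or4P[h|h|h|/orP[]/andP[h1 h2]].
- by apply: (sub (mon e.+1 0 0 0 0)); [rewrite !inE eqxx | exact: le].
- by apply: (sub (mon 0 e.+1 0 0 0)); [rewrite !inE eqxx !orbT | exact: le].
- by apply: (sub (mon 0 0 e.+1 0 0)); [rewrite !inE eqxx !orbT | exact: le].
- by apply: (sub (mon 1 e 0 0 0)); [rewrite !inE eqxx !orbT | exact: le].
- by apply: (sub (mon 1 0 e 0 0)); [rewrite !inE eqxx !orbT | exact: le].
Qed.

Lemma bad_support_ideal f : (forall m, f@_m != 0 -> bad_mon m) -> I f.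
Proof.
move=> h; rewrite [f]mpolyE; apply: ideal_sum => m; rewrite mcoeff_msupp => hm.
by apply: idealZ; apply: bad_mon_ideal; exact: h.
Qed.

Lemma same_key_mon t x y p q n :
  I ('X_[mon t (x + n) y (p + e * n) q] - 'X_[mon t x (y + n) p (q + e * n)]).
Proof.
have -> : mon t (x + n) y (p + e * n) q = (mon t x y p q + mon 0 1 0 e 0 *+ n)%MM.
  by rewrite monX monD !mul0n !mul1n !addn0.
have -> : mon t x (y + n) p (q + e * n) = (mon t x y p q + mon 0 0 1 0 e *+ n)%MM.
  by rewrite monX monD !mul0n !mul1n !addn0.
rewrite !mpolyXD -!mpolyXn -mulrBr subrXX; apply: idealM; rewrite mulrC.
apply: idealM; rewrite the_idealE; apply: ideal_gen_mem.
by rewrite !inE eqxx !orbT.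
Qed.

Lemma same_key_ideal m m' : key m = key m' -> I ('X_[m] - 'X_[m']).
Proof.
rewrite (mon_eta m) (mon_eta m') !key_mon.
move: (m _) (m _) (m _) (m _) (m _) (m' _) (m' _) (m' _) (m' _) (m' _).
move=> q p y x t q' p' y' x' t' [-> hs hP hQ].
wlog le : x y p q x' y' p' q' hs hP hQ / (x' <= x)%N.
  move=> W; case: (leqP x' x) => h; first exact: W.
  rewrite -opprB -sub0r; apply: idealB; first exact: ideal0.
  by apply: W => //; exact: ltnW.
have [n ex] : exists n, x = (x' + n)%N by exists (x - x')%N; lia.
have ey : y' = (y + n)%N by lia.
have ep : p = (p' + e * n)%N by nia.
have eq : q' = (q + e * n)%N by nia.
by rewrite ex ey ep eq; exact: same_key_mon.
Qed.

(** One representative per class, chosen bad whenever the class has a bad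
    monomial. *)
Lemma exists_class_repr (c : nat * nat * nat * nat) : exists m0, 
  (exists m, key m = c) -> key m0 = c /\ ((exists2 m, key m = c & bad_mon m) -> bad_mon m0).
Proof.
have [[m h1 h2]|no] := classic (exists2 m, key m = c & bad_mon m); first by exists m.
have [[m h]|no'] := classic (exists m, key m = c); first by exists m => _; split=> // /no.
by exists 0%MM => /no'.
Qed.

Definition class_repr c : 'X_{1..5} := proj1_sig (constructive_indefinite_description _ (exists_class_repr c)).

Lemma class_reprP c : (exists m, key m = c) ->
  key (class_repr c) = c /\ ((exists2 m, key m = c & bad_mon m) -> bad_mon (class_repr c)).
Proof. by rewrite /class_repr; case: constructive_indefinite_description. Qed.

(** Class sums over alive classes kill every multiple of a generator. Conversely,
    replacing monomials by the representatives of their classes changes f by a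
    multiple of the binomial, and leaves only bad monomials when these sums
    vanish. *)
Lemma mem_idealP f : I f <-> forall c, alive c -> csum c f = 0.
Proof.
split=> [|h].
  rewrite the_idealE => hf c [_ good].
  elim/ideal_gen_ind: f / hf => [|f g hf hg|f g hg].
  - exact: linear0.
  - by rewrite linearD /= hf hg addr0.
  have hbad m0 : bad_mon m0 -> csum c (f * 'X_[m0]) = 0.
    move=> hb; rewrite mulrC csumMX big1 // => m _.
    case: eqP => [hk|]; last by rewrite mulr0.
    have := good _ hk; rewrite /bad_mon !mnmDE.
    by move: hb; rewrite /bad_mon /bad_exp; lia.
  move: hg; rewrite !inE => /orP[|/orP[|/orP[|/orP[|/orP[|]]]]] /eqP ->; last first.
    rewrite mulrBr linearB /= ![f * _]mulrC !csumMX -sumrB big1 // => m _.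
    rewrite (mon_eta m) !monD !key_mon; apply/eqP; rewrite subr_eq0; apply/eqP.
    congr (_ * (nat_of_bool (_ == c))%:R); congr (_, _, _, _); nia.
  1-5: by apply: hbad; rewrite /bad_mon !monE /bad_exp; lia.
pose f' := \sum_(m <- msupp f) f@_m *: 'X_[class_repr (key m)].
have hff' : I (f - f').
  rewrite {1}[f]mpolyE /f' -sumrB; apply: ideal_sum => m _.
  rewrite -scalerBr; apply/idealZ/same_key_ideal.
  by case: (class_reprP (ex_intro _ m erefl)).
rewrite -[f](subrK f'); apply: idealD => //; apply: bad_support_ideal => m0.
rewrite raddf_sum /=; under eq_bigr do rewrite mcoeffZ mcoeffX.
have [hr|hr] := eqVneq (class_repr (key m0)) m0; last first.
  rewrite big1 ?eqxx // => m _; case: eqP => [hm|]; last by rewrite mulr0.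
  case/eqP: hr; rewrite -{2}hm; congr class_repr; rewrite -hm.
  by case: (class_reprP (ex_intro _ m erefl)).
have -> : \sum_(m <- msupp f) f@_m * (class_repr (key m) == m0)%:R = csum (key m0) f.
  apply: eq_bigr => m _; congr (_ * (nat_of_bool _)%:R).
  apply/eqP/eqP => [<-|->] //.
  by case: (class_reprP (ex_intro _ m erefl)).
move=> nz; apply: contraNT nz => good; apply/eqP; apply: h; split; first by exists m0.
move=> m hm; apply/negP => hb; move/negP: good; apply.
rewrite -hr; have [_] := class_reprP (ex_intro _ m0 erefl); apply.
by exists m.
Qed.

End Ideal.

(** * Koszul homology of the quotient for x_4 and x_5 *)

Definition decide (A : Prop) : bool := if excluded_middle_informative A then true else false.

Lemma decideP A : reflect A (decide A).
Proof. by rewrite /decide; case: excluded_middle_informative => h; constructor. Qed.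

Section Classes.
Variables (k : fieldType) (e : nat).
Hypothesis e_gt0 : (0 < e)%N.
Local Notation S := {mpoly k[5]}.
Notation ix j := (inord j : 'I_5).
Local Notation I := (@the_ideal k e.+1).
Local Notation z := ('X_(ix 3) : S).
Local Notation w := ('X_(ix 4) : S).

Lemma alive_good t s P Q : alive e (t, s, P, Q) ->
  forall x y p q, rep e s P Q x y p q -> ~~ bad_exp e t x y.
Proof.
move=> [_ good] x y p q [h1 h2 h3].
by have := good (mon t x y p q); rewrite key_mon h1 h2 h3 /bad_mon !monE => /(_ erefl).
Qed.

Lemma good_alive t s P Q x0 y0 p0 q0 : rep e s P Q x0 y0 p0 q0 ->
  (forall x y p q, rep e s P Q x y p q -> ~~ bad_exp e t x y) -> alive e (t, s, P, Q).
Proof.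
move=> [h1 h2 h3] good; split; first by exists (mon t x0 y0 p0 q0); rewrite key_mon h1 h2 h3.
move=> m [h0 h1' h2' h3']; rewrite /bad_mon h0.
by apply: (good _ _ (m (ix 3)) (m (ix 4))); split.
Qed.

Lemma dead_bad t s P Q x0 y0 p0 q0 : rep e s P Q x0 y0 p0 q0 ->
  ~ alive e (t, s, P, Q) ->
  exists x y p q, rep e s P Q x y p q /\ bad_exp e t x y.
Proof.
move=> hr na; apply: NNPP => no; apply: na; apply: good_alive hr _ => x y p q hr.
by apply/negP => hb; apply: no; exists x, y, p, q.
Qed.

Lemma csum_rep t s P Q (f : S) a : zhomog a f -> csum e (t, s, P, Q) f != 0 ->
  exists x y p q, [/\ rep e s P Q x y p q, f@_(mon t x y p q) != 0
    & (t + x + y + p + q)%N%:Z = a].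
Proof.
move=> /zhomogP hf /csum_neq0 [m hm [e1 e2 e3 e4]].
exists (m (ix 1)), (m (ix 2)), (m (ix 3)), (m (ix 4)).
by rewrite -mdeg_mon -e1 -mon_eta hf.
Qed.

(** H_2: if a class sum of f is nonzero, both multiples of this class are dead, so
    its degree is bounded. *)
Lemma socle_small a (f : S) : zhomog a f -> (deg_bound e)%:Z < a ->
  I (z * f) -> I (w * f) -> I f.
Proof.
move=> hf ha /(mem_idealP e_gt0) hz /(mem_idealP e_gt0) hw.
apply/(mem_idealP e_gt0) => -[[[t s] P] Q] al; apply/eqP/negPn/negP => nz.
have [x [y [p [q [hr _ hdeg]]]]] := csum_rep hf nz.
have [al1|na1] := classic (alive e (t, s, P.+1, Q)).
  by case/eqP: nz; rewrite -csum_z hz.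
have [al2|na2] := classic (alive e (t, s, P, Q.+1)).
  by case/eqP: nz; rewrite -csum_w hw.
have hr1 : rep e s P.+1 Q x y p.+1 q by case: hr => *; split; lia.
have hr2 : rep e s P Q.+1 x y p q.+1 by case: hr => *; split; lia.
have [x1 [y1 [p1 [q1 [r1 b1]]]]] := dead_bad hr1 na1.
have [x2 [y2 [p2 [q2 [r2 b2]]]]] := dead_bad hr2 na2.
have := socle_degree e_gt0 hr (alive_good al) r1 b1 r2 b2.
lia.
Qed.

(** H_0: the monomials in x_1, x_2, x_3 outside of the ideal have degree at most
    d^2 - 2. *)
Lemma generated_small a (f : S) : zhomog a f -> (deg_bound e)%:Z < a ->
  exists f1 f2, [/\ zhomog (a - 1) f1, zhomog (a - 1) f2 & I (f - z * f1 - w * f2)].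
Proof.
move=> hf ha; pose f1 := xdiv (ix 3) f; pose g := f - z * f1; pose f2 := xdiv (ix 4) g.
have hf1 : zhomog (a - 1) f1 by exact: zhomog_xdiv.
have hg : zhomog a g.
  by apply: zhomogB => //; apply: (zhomogMl (zhomogXU _ _) hf1); lia.
exists f1, f2; split=> //; first exact: zhomog_xdiv.
have cf (j : 'I_5) (h : S) m : (h - 'X_j * xdiv j h)@_m = if m j == 0%N then h@_m else 0.
  rewrite mcoeffB mcoeff_mulXU mcoeff_xdiv; case: (m j =P 0%N) => [_|/eqP nz].
    by rewrite subr0.
  by rewrite submK ?subrr // lep1mP.
apply: bad_support_ideal => m; rewrite cf; case: (m _ =P 0%N) => [m4|_]; last by rewrite eqxx.
rewrite cf; case: (m _ =P 0%N) => [m3|_]; last by rewrite eqxx.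
move=> nz; apply/negPn/negP => /(good_degree e_gt0) hgd.
have /zhomogP/(_ _ nz) := hf; rewrite [m]mon_eta mdeg_mon m3 m4 !addn0; lia.
Qed.

(** Allows a polynomial to be defined by its class sums: one representative of each
    class carries the whole sum. *)
Lemma csum_lift (L : seq (nat * nat * nat * nat)) (pi : nat * nat * nat * nat -> k) :
  (forall c, pi c != 0 -> c \in L /\ exists m, key e m = c) ->
  exists p : S, forall c, csum e c p = pi c.
Proof.
move=> h; exists (\sum_(c <- undup L) pi c *: 'X_[class_repr e c]) => c.
rewrite raddf_sum /=; under eq_bigr do rewrite linearZ /= csumX.
have E c' : pi c' * (key e (class_repr e c') == c)%:R = pi c' * (c' == c)%:R.
  have [->|nz] := eqVneq (pi c') 0; first by rewrite !mul0r.
  by have [_ /class_reprP [-> _]] := h _ nz.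
under eq_bigr do rewrite E.
have [hc|hc] := boolP (c \in undup L).
  rewrite (bigD1_seq c) ?undup_uniq //= eqxx mulr1 big1 ?addr0 // => c' /negbTE ->.
  by rewrite mulr0.
have -> : pi c = 0.
  by apply/eqP/negPn/negP => /h [hL _]; move: hc; rewrite mem_undup hL.
rewrite big_seq big1 // => c' hc'; case: eqP => [e'|]; last by rewrite mulr0.
by rewrite -e' hc' in hc.
Qed.

(** A class of large degree without multiples of x_5 stays alive, and without
    multiples of x_5, after multiplication by x_4. Hence w g does not
    contribute to the class sum of the relation, and f has class sum zero. *)
Lemma class_vanish_w a (f g : S) t s P Q : zhomog a f -> (deg_bound e)%:Z < a ->
  I (z * f + w * g) -> alive e (t, s, P, Q) ->
  (forall x y p q, rep e s P Q x y p q -> q = 0%N) ->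
  csum e (t, s, P, Q) f = 0.
Proof.
move=> hf ha /(mem_idealP e_gt0) hI al noq; apply/eqP/negPn/negP => nz.
have [x [y [p [q [hr _ hdeg]]]]] := csum_rep hf nz.
have lt : (deg_bound e < t + x + y + p + q)%N by lia.
have H := no_w_good e_gt0 hr (alive_good al) noq lt.
have hr1 : rep e s P.+1 Q x y p.+1 q by case: hr => *; split; lia.
have al1 : alive e (t, s, P.+1, Q).
  by apply: good_alive hr1 _ => ? ? ? ? /H [].
have := hI _ al1; rewrite linearD /= csum_z => h0.
suff hg : csum e (t, s, P.+1, Q) (w * g) = 0 by case/eqP: nz; move: h0; rewrite hg addr0.
case: Q al noq nz hr H hr1 al1 h0 => [|Q] al noq nz hr H hr1 al1 h0; first exact: csum_w0.
rewrite csum_w; apply/eqP/negPn/negP => /csum_neq0 [m _ [e1 e2 e3 e4]].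
have [|_] := H (m (ix 1)) (m (ix 2)) (m (ix 3)) (m (ix 4)).+1; last by [].
by split; lia.
Qed.

Lemma class_vanish_z a (f g : S) t s P Q : zhomog a g -> (deg_bound e)%:Z < a ->
  I (z * f + w * g) -> alive e (t, s, P, Q) ->
  (forall x y p q, rep e s P Q x y p q -> p = 0%N) ->
  csum e (t, s, P, Q) g = 0.
Proof.
move=> hf ha /(mem_idealP e_gt0) hI al noq; apply/eqP/negPn/negP => nz.
have [x [y [p [q [hr _ hdeg]]]]] := csum_rep hf nz.
have lt : (deg_bound e < t + x + y + p + q)%N by lia.
have H := no_z_good e_gt0 hr (alive_good al) noq lt.
have hr1 : rep e s P Q.+1 x y p q.+1 by case: hr => *; split; lia.
have al1 : alive e (t, s, P, Q.+1).
  by apply: good_alive hr1 _ => ? ? ? ? /H [].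
have := hI _ al1; rewrite linearD /= csum_w => h0.
suff hg : csum e (t, s, P, Q.+1) (z * f) = 0 by case/eqP: nz; move: h0; rewrite hg add0r.
case: P al noq nz hr H hr1 al1 h0 => [|P] al noq nz hr H hr1 al1 h0; first exact: csum_z0.
rewrite csum_z; apply/eqP/negPn/negP => /csum_neq0 [m _ [e1 e2 e3 e4]].
have [|_] := H (m (ix 1)) (m (ix 2)) (m (ix 3)).+1 (m (ix 4)); last by [].
by split; lia.
Qed.

(** H_1: p is prescribed by its class sums. On a class c, the sum has to be that of
    f on x_5 c, and minus that of g on x_4 c. These agree when both classes are
    alive, as x_4 x_5 c is then alive too and the relation can be read there. *)
Lemma syzygy_small a (f g : S) : zhomog a f -> zhomog a g -> (deg_bound e)%:Z < a ->
  I (z * f + w * g) ->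
  exists p, [/\ zhomog (a - 1) p, I (f - w * p) & I (g + z * p)].
Proof.
move=> hf hg ha hI.
have hI' := proj1 (mem_idealP e_gt0 _) hI.
pose up c : nat * nat * nat * nat := let: (t, s, P, Q) := c in (t, s, P.+1, Q).
pose uq c : nat * nat * nat * nat := let: (t, s, P, Q) := c in (t, s, P, Q.+1).
pose dp c : nat * nat * nat * nat := let: (t, s, P, Q) := c in (t, s, P.-1, Q).
pose dq c : nat * nat * nat * nat := let: (t, s, P, Q) := c in (t, s, P, Q.-1).
pose pi c := if decide (exists m, key e m = c) then
    if decide (alive e (uq c)) then csum e (uq c) f
    else if decide (alive e (up c)) then - csum e (up c) g else 0
  else 0.
pose L := [seq dq (key e m) | m <- msupp f] ++ [seq dp (key e m) | m <- msupp g].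
have [|p hp] := @csum_lift L pi.
  move=> [[[t s] P] Q]; rewrite /pi /=; case: decideP => [hm|]; last by rewrite eqxx.
  case: decideP => [_|_].
    move=> /csum_neq0 [m hm1 em]; split=> //; rewrite mem_cat.
    by apply/orP; left; apply/mapP; exists m; rewrite ?mcoeff_msupp // em.
  case: decideP => [_|_]; last by rewrite eqxx.
  rewrite oppr_eq0 => /csum_neq0 [m hm1 em]; split=> //; rewrite mem_cat.
  by apply/orP; right; apply/mapP; exists m; rewrite ?mcoeff_msupp // em.
have h1 : I (f - w * p).
  apply/(mem_idealP e_gt0) => -[[[t s] P] Q] al; rewrite linearB /=.
  have [[x [y [p' [q' hr]]]]|no] :=
      classic (exists x y p q, rep e s P Q x y p q.+1); last first.
    rewrite (class_vanish_w hf ha hI al); last first.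
      by move=> x y p' [|q'] hr //; case: no; exists x, y, p', q'.
    case: Q al no => [|Q] al no; first by rewrite csum_w0 subrr.
    rewrite csum_w hp /pi /=; case: decideP => [[m [e1 e2 e3 e4]]|_]; last by rewrite subrr.
    case: no; exists (m (ix 1)), (m (ix 2)), (m (ix 3)), (m (ix 4)).
    by split; lia.
  case: Q al hr => [|Q] al hr; first by case: hr; lia.
  rewrite csum_w hp /pi /=; case: decideP => [_|[]]; last first.
    by exists (mon t x y p' q'); rewrite key_mon; case: hr => <- <- hq; congr (_, _, _, _); lia.
  by case: decideP => // _; rewrite subrr.
have h2 : I (g + z * p).
  apply/(mem_idealP e_gt0) => -[[[t s] P] Q] al; rewrite linearD /=.
  have [[x [y [p' [q' hr]]]]|no] :=
      classic (exists x y p q, rep e s P Q x y p.+1 q); last first.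
    rewrite (class_vanish_z hg ha hI al); last first.
      by move=> x y [|p'] q' hr //; case: no; exists x, y, p', q'.
    case: P al no => [|P] al no; first by rewrite csum_z0 addr0.
    rewrite csum_z hp /pi /=; case: decideP => [[m [e1 e2 e3 e4]]|_]; last by rewrite addr0.
    case: no; exists (m (ix 1)), (m (ix 2)), (m (ix 3)), (m (ix 4)).
    by split; lia.
  case: P al hr => [|P] al hr; first by case: hr; lia.
  have hr0 : rep e s P Q x y p' q' by case: hr => *; split; lia.
  rewrite csum_z hp /pi /=; case: decideP => [_|[]]; last first.
    by exists (mon t x y p' q'); rewrite key_mon; case: hr0 => <- <- <-.
  case: decideP => [al'|_]; last by case: decideP => // _; rewrite subrr.
  have al2 : alive e (t, s, P.+1, Q.+1).
    have hr2 : rep e s P.+1 Q.+1 x y p'.+1 q'.+1 by case: hr0 => *; split; lia.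
    exact: good_alive hr2 (join_good e_gt0 hr0 (alive_good al) (alive_good al')).
  by have := hI' _ al2; rewrite linearD /= csum_z csum_w addrC.
exists (zproj (a - 1) p); split; first exact: zproj_homog.
- have := ideal_zproj e_gt0 a h1.
  by rewrite -mulNr zprojD (zproj_id hf) (zproj_mull _ _ (zhomogN (zhomogXU _ _))) mulNr.
- have := ideal_zproj e_gt0 a h2.
  by rewrite zprojD (zproj_id hg) (zproj_mull _ _ (zhomogXU _ _)).
Qed.

End Classes.

(** * Regularity *)

Section Final.
Variables (k : fieldType) (e : nat).
Hypothesis e_gt0 : (0 < e)%N.
Local Notation S := {mpoly k[5]}.
Notation ix j := (inord j : 'I_5).
Local Notation I := (@the_ideal k e.+1).
Local Notation A := (@vhomog k 5 1 shift0).
Local Notation N := (vgr shift0 (row_ideal I)).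

Lemma row_ideal_closed : lin_closed (row_ideal I).
Proof.
split=> [|u v hu hv|x v hv]; rewrite /row_ideal !mxE.
- exact: ideal0.
- exact: idealB.
- exact: idealM.
Qed.

Lemma vhomog1 a (v : 'rV[S]_1) : zhomog a (v 0 0) -> A a v.
Proof. by move=> h j; rewrite ord1 subr0. Qed.

Lemma vhomog1E a (v : 'rV[S]_1) : A a v -> zhomog a (v 0 0).
Proof. by move/(_ 0); rewrite subr0. Qed.

Let Agr js := vhomog_graded k shift0 js : graded_sub (vars k js) A.
Let Ngr js : graded_sub (vars k js) N.
Proof.
have [h0 hB hZ] := vgr_graded shift0 row_ideal_closed.
split=> // a x v /mapP [j _ ->]; apply: hZ.
by apply: map_f; rewrite mem_enum.
Qed.

(** In the Koszul complex of (x_4, x_5), the pair ((f, g), (h, k)) is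
    f + e_5 g + e_4 h + e_4 e_5 k. *)
Lemma kvanish_zw i a : (deg_bound e)%:Z + i%:Z < a ->
  kvanish A N (vars k [:: ix 3; ix 4]) i a.
Proof.
case: i => [|[|[|i]]] ha; last by apply: kvanish_big => //; exact: Agr.
- move=> [[f u] [u' u'']] /= [[hf ->] [-> ->]] _.
  have [f1 [f2 [h1 h2 h3]]] := generated_small e_gt0 (vhomog1E hf) ltac:(lia).
  exists ((0, const_mx f2), (const_mx f1, 0)) => /=.
    split; split=> //; apply: vhomog1; by rewrite mxE.
  have e1 : (f - (0 + 'X_(ix 4) *: const_mx f2 + 'X_(ix 3) *: const_mx f1)) 0 0 =
      f 0 0 - 'X_(ix 3) * f1 - 'X_(ix 4) * f2.
    by rewrite !mxE add0r opprD addrCA addrC addrAC.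
  split; last first.
    rewrite -[(0, 0)]/(0 : koszul 'rV[S]_1 [:: 'X_(ix 4)]) sub0r opprK.
    by rewrite scaler0 addr0 oppr0.
  split; last by rewrite scaler0 oppr0 addr0 subr0.
  split; last by rewrite /row_ideal e1.
  apply: vhomog1; rewrite e1; have hX := zhomogXU k.
  apply: zhomogB; last by apply: (zhomogMl (hX _ _) h2); lia.
  apply: zhomogB; first exact: vhomog1E.
  by apply: (zhomogMl (hX _ _) h1); lia.
- move=> [[u g] [f u']] /= [[-> hg] [hf ->]] [[[_ hd] _] _].
  have hI : I ('X_(ix 3) * f 0 0 + 'X_(ix 4) * g 0 0).
    by move: hd; rewrite /row_ideal !mxE add0r addrC.
  have [p [hp h1 h2]] := syzygy_small e_gt0 (vhomog1E hf) (vhomog1E hg) ltac:(lia) hI.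
  exists ((0, 0), (0, - const_mx p)) => /=.
    by do !split; apply: vhomog1; rewrite !mxE; exact: zhomogN.
  split; split.
  - by rewrite !scaler0 !addr0 subrr.
  - split; last by rewrite /row_ideal !mxE oppr0 add0r mulrN opprK.
    apply: vhomog1; rewrite !mxE oppr0 add0r mulrN opprK.
    apply: zhomogD; first exact: vhomog1E.
    by apply: (zhomogMl (zhomogXU k _) hp); lia.
  - split; last by rewrite /row_ideal !mxE add0r opprK mulrN.
    apply: vhomog1; rewrite !mxE add0r opprK mulrN.
    apply: zhomogB; first exact: vhomog1E.
    by apply: (zhomogMl (zhomogXU k _) hp); lia.
  - by rewrite !oppr0 addr0.
- move=> [[u u'] [u'' f]] /= [[-> ->] [-> hf]] [[hd1 [_ hd2]] [[_ hd3] hd4]].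
  exists 0 => /=; first by do !split.
  split; split.
  - by rewrite !scaler0 !addr0 subr0.
  - by rewrite scaler0 oppr0 addr0 subr0.
  - by rewrite scaler0 addr0 !oppr0 addr0.
  - rewrite !oppr0 addr0; split=> //.
    apply: (socle_small e_gt0 (vhomog1E hf)); first by lia.
      by move: hd2; rewrite /row_ideal !mxE oppr0 add0r.
    by move: hd3; rewrite /row_ideal !mxE add0r => /(idealB (ideal0 _ _)); rewrite sub0r opprK.
Qed.

Lemma kvanish_add_vars js : (forall i a, (deg_bound e)%:Z + i%:Z < a ->
  kvanish A N (vars k [:: ix 3; ix 4]) i a) ->
  forall i a, (deg_bound e)%:Z + i%:Z < a ->
  kvanish A N (vars k (js ++ [:: ix 3; ix 4])) i a.
Proof.
move=> h; elim: js => [//|j js IH] i a ha.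
apply: kvanish_cons; [exact: (Agr (j :: _)) | exact: (Ngr (j :: _)) | exact: IH |].
by move=> i0; apply: IH; lia.
Qed.

Lemma ideal_kvanish_large i a : (deg_bound e)%:Z + i%:Z < a -> ideal_kvanish I i a.
Proof.
move=> ha; rewrite /ideal_kvanish enum5.
exact: (@kvanish_add_vars [:: ix 0; ix 1; ix 2] kvanish_zw).
Qed.

(** The class of x_2 x_3^e x_4^(e-1) x_5^(e^2-1) attains equality in the degree
    bound of the classes killed by x_4 and x_5. *)
Definition socle_mon : 'X_{1..5} := mon 0 1 e e.-1 (e * e).-1.

Lemma socle_mon_notin : ~ I 'X_[socle_mon].
Proof.
move=> /(mem_idealP e_gt0) /(_ (key e socle_mon)) h.
have : csum e (key e socle_mon) ('X_[socle_mon] : S) = 0.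
  apply: h; split; first by exists socle_mon.
  move=> m; rewrite key_mon /bad_mon /bad_exp => -[-> h1 h2 h3].
  by nia.
by rewrite csumX eqxx => /eqP; rewrite oner_eq0.
Qed.

(** After multiplication by any variable, some exchanges lead to a bad monomial. *)
Lemma socle_mon_mul j : I ('X_j * 'X_[socle_mon]).
Proof.
have same m m' : key e m = key e m' -> bad_mon e m' -> I 'X_[m].
  move=> hk hb; rewrite -['X_[m]](subrK 'X_[m']); apply: idealD => //.
    exact: same_key_ideal.
  exact: bad_mon_ideal.
have : j \in enum 'I_5 by rewrite mem_enum.
rewrite -mpolyXD enum5 !inE => /orP[|/orP[|/orP[|/orP[|]]]] /eqP ->; rewrite U_mon monD ?add0n ?addn0.
- by apply: (same _ _ erefl); rewrite /bad_mon !monE /bad_exp; lia.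
- apply: (@same _ (mon 0 e.+1 1 (e * e).-1 e.-1)).
    by rewrite !key_mon; congr (_, _, _, _); nia.
  by rewrite /bad_mon !monE /bad_exp; lia.
- by apply: (same _ _ erefl); rewrite /bad_mon !monE /bad_exp; lia.
- apply: (@same _ (mon 0 0 e.+1 0 (e * e + e).-1)).
    by rewrite !key_mon; congr (_, _, _, _); nia.
  by rewrite /bad_mon !monE /bad_exp; lia.
- apply: (@same _ (mon 0 e.+1 0 (e.-1 + e * e) 0)).
    by rewrite !key_mon; congr (_, _, _, _); nia.
  by rewrite /bad_mon !monE /bad_exp; lia.
Qed.

Lemma socle_nonvanish : ~ ideal_kvanish I 5 ((deg_bound e)%:Z + 5%:Z).
Proof.
have hs : size (vars k (enum 'I_5)) = 5%N by rewrite size_map size_enum_ord.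
rewrite /ideal_kvanish -[in X in kvanish _ _ _ X]hs -[in X in _ + X]hs => h.
have [] := @socle_kvanish _ _ _ _ _ (deg_bound e)%:Z (const_mx 'X_[socle_mon]) (Agr _) (Ngr _) _ _ h.
- apply: vhomog1; rewrite mxE; have := zhomogX k socle_mon.
  rewrite mdeg_mon; congr (zhomog (Posz _) _).
  by rewrite /deg_bound; nia.
- move=> _ /mapP [j _ ->]; split.
    apply: vhomog1; rewrite !mxE -mpolyXD; have := zhomogX k (U_(j) + socle_mon).
    rewrite mdegD mdeg1 mdeg_mon; congr (zhomog _ _).
    by rewrite /deg_bound; nia.
  by rewrite /row_ideal !mxE; exact: socle_mon_mul.
by move=> _; rewrite /row_ideal mxE; exact: socle_mon_notin.
Qed.

End Final.

Theorem theorem2p5 (k : fieldType) (hk : [pchar k] =i pred0)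
    (d : nat) (hd : (2 <= d)%N) :
  reg_eq (@the_ideal k d) (d%:Z ^+ 2 - 1).
Proof.
case: d hd => // e; rewrite ltnS => e_gt0.
have -> : e.+1%:Z ^+ 2 - 1 = (deg_bound e)%:Z + 1 by rewrite /deg_bound expr2; nia.
split.
  apply: (exists_minimal_resolution (c := (deg_bound e)%:Z)).
  - exact: idealB.
  - exact: idealM.
  - exact: ideal0.
  - exact: ideal_no_const.
  - exact: ideal_zproj.
  - exact: ideal_kvanish_large.
move=> F HF; apply: (@regularity_of_kvanish _ _ _ F HF _ _ 4%N).
- exact: ideal_no_const.
- exact: ideal_kvanish_large.
- exact: socle_nonvanish.
Qed.
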